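(* Let $A$, $\alpha$, $T$, $C$, $\mathcal O$, $\omega$, $\mathcal K_\alpha$ and $H_\alpha=\chi_\omega^n\nabla\mathcal K_\alpha^*$ be as defined in the context. The following statements are equivalent: 1. The system ${}^{C}\mathcal D_{0^+}^{\alpha}u=Au$ in $Q_T$, $u=0$ on $\Sigma_T$, $u(\cdot,0)=u_0$ in $\Omega$, augmented with the output $z(t)=Cu(t)$, is exactly $G$-observable in $\omega$. 2. $\operatorname{Ker}(H_\alpha^* )=\{0\}$ and $\operatorname{Im}(H_\alpha)$ is closed. 3. There exists $c>0$ such that $\|u\|_{(L^2(\omega))^n}\le c\,\|H_\alpha^*u\|_{L^2(0,T;\mathcal O)}$ for all $u\in(L^2(\omega))^n$.
   Context: Let $\Omega\subset\mathbb R^n$ ($n\ge1$) be open, bounded and connected with Lipschitz boundary, $T>0$, $\alpha\in(0,1]$, $Q_T=\Omega\times[0,T]$, $\Sigma_T=\partial\Omega\times[0,T]$, $E=L^2(\Omega)$. The operator $A$ on $E$ has domain $\mathcal D(A)=H^2(\Omega)\cap H^1_0(\Omega)$ and $Ay=\sum_{k,l=1}^n\partial_{x_k}(a_{k,l}\,\partial_{x_l}y)$, with $a_{k,l}\in C^1(\overline\Omega)$, $a_{k,l}=a_{l,k}$, and there is $\mu>0$ with $\sum_{k,l}a_{k,l}(x)\varsigma_k\varsigma_l\ge\mu\|\varsigma\|^2$ for all $x\in\Omega$, $\varsigma\in\mathbb R^n$. The eigenvalues of $-A$ are $0<\lambda_1<\lambda_2<\cdots\to+\infty$; $\lambda_i$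 has finite multiplicity $r_i$ with eigenfunctions $\varphi_{i,j}\in\mathcal D(A)$, $-A\varphi_{i,j}=\lambda_i\varphi_{i,j}$, $1\le j\le r_i$, and $\{\varphi_{i,j}\}$ is an orthonormal basis of $E$. The Caputo derivative is ${}^{C}\mathcal D_{0^+}^{\alpha}u(\cdot,t)=\int_0^t\frac{(t-e)^{-\alpha}}{\Gamma(1-\alpha)}\partial_e u(\cdot,e)\,de$ (the ordinary derivative if $\alpha=1$). For $u_0\in H_0^1(\Omega)$ the mild solution of the system is $u(t)=\mathcal S_\alpha(t)u_0:=\sum_{i\ge1}E_\alpha(-\lambda_it^\alpha)\sum_{j=1}^{r_i}\langle u_0,\varphi_{i,j}\rangle\varphi_{i,j}$, where $E_\alpha(z)=\sum_{k\ge0}z^k/\Gamma(\alpha k+1)$. The observation operator $C:E\to\mathcal O$ (linear, possibly unbounded; $\mathcal O$ a Hilbert space) satisfies the admissibility condition: there is $M>0$ with $\int_0^T\|C\mathcal S_\alpha(t)v\|_{\mathcal O}^2dt\le M\|v\|_E^2$ for all $v\in\mathcal D(A)$. The observability operator is $\mathcal K_\alpha:\mathcal D(\mathcal K_\alpha)\subset E\to L^2(0,T;\mathcal O)$, $(\mathcal K_\alpha u_0)(t)=C\mathcal S_\alpha(t)u_0$, with adjoint $\mathcal K_\alpha^*z=\int_0^T\mathcal S_\alpha^*(e)C^*z(e)\,de$. $\omega\subset\Omega$ is a subregion; $\chi_\omega^n:E^n\to(L^2(\omega))^n$ is componentwise restriction to $\omega$, and its adjoint $(\chi_\omega^n)^*$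 is componentwise extension by $0$ to $\Omega$. $\nabla:\mathcal D(\nabla)=H_0^1(\Omega)\subset E\to E^n$ is the gradient. Set $H_\alpha=\chi_\omega^n\nabla\mathcal K_\alpha^*$, an operator from (a subspace of) $L^2(0,T;\mathcal O)$ to $(L^2(\omega))^n$. The system with output is called exactly $G$-observable in $\omega$ if $\operatorname{Im}(H_\alpha)=(L^2(\omega))^n$.
   Formalization: Statement 3 implies statement 1 is proved only when H_α is a closed operator (it fails in general for unbounded, non-closed H_α); in statement 3 the vector u ranges over the domain of H_α^*, with the norm of H_α^*u read as infinite outside it. *)

(* Defs.v *)
(* All Hilbert spaces are real. *)
From HB Require Import structures.
From mathcomp Require Import all_boot all_order all_algebra.
From mathcomp Require Import all_classical all_reals all_analysis.

Set Implicit Arguments.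
Unset Strict Implicit.
Unset Printing Implicit Defensive.
Import Order.TTheory GRing.Theory Num.Theory.
Import numFieldNormedType.Exports.
Local Open Scope classical_set_scope.
Local Open Scope ring_scope.

(* [rV_display] is the display of the product sigma-algebra on R^n, which is
   the Borel sigma-algebra (see [open_rV_measurable]). *)
Definition rV_display : measure_display. Proof. exact. Qed.

Section measurable_rV.
Context {R : realType} {n : nat}.

Definition rV_coord (i : 'I_n) (x : 'rV[R]_n) : measurableTypeR R := x 0 i.

Let rV_set0 : g_sigma_preimage rV_coord set0.
Proof. exact: sigma_algebra0. Qed.

Let rV_setC A : g_sigma_preimage rV_coord A -> g_sigma_preimage rV_coord (~` A).
Proof. exact: sigma_algebraC. Qed.

Let rV_bigcup (F : _^nat) : (forall i, g_sigma_preimage rV_coord (F i)) ->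
  g_sigma_preimage rV_coord (\bigcup_i (F i)).
Proof. exact: sigma_algebra_bigcup. Qed.

HB.instance Definition _ := @isMeasurable.Build rV_display
  'rV[R]_n (g_sigma_preimage rV_coord) rV_set0 rV_setC rV_bigcup.

Lemma measurable_rV_coord (i : 'I_n) :
  measurable_fun [set: 'rV[R]_n] (rV_coord i).
Proof.
move=> _ Y mY; rewrite setTI; apply: sub_sigma_algebra => /=.
rewrite -bigcup_seq/=; exists i => /=; first by rewrite mem_index_enum.
by exists Y => //; rewrite setTI.
Qed.

Lemma measurable_fun_rVP d (T : measurableType d) (f : T -> 'rV[R]_n) :
  (forall i, measurable_fun setT (rV_coord i \o f)) -> measurable_fun setT f.
Proof.
move=> mf _ A mA; rewrite setTI.
have [mT mC mU] : sigma_algebra setT [set B | measurable (f @^-1` B)].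
  split => /=.
  - by rewrite preimage_set0.
  - move=> B mB; rewrite setTD preimage_setC; exact: measurableC.
  - by move=> F mF; rewrite preimage_bigcup; exact: bigcup_measurable.
apply: (mA [set B | measurable (f @^-1` B)]); split=> //.
rewrite -bigcup_seq => B [i _ [Y mY <-]] /=.
rewrite setTI -comp_preimage -[X in measurable X]setTI; exact: mf.
Qed.

Lemma open_rV_measurable (A : set 'rV[R]_n) : open A -> measurable A.
Proof.
move=> oA.
pose box (qk : {ffun 'I_n -> rat} * nat) : set 'rV[R]_n :=
  \bigcap_(i in [set: 'I_n]) (rV_coord i @^-1` ball (ratr (qk.1 i) : R) qk.2.+1%:R^-1).
have mbox qk : measurable (box qk).
  apply: fin_bigcap_measurable => // i _; rewrite -[X in measurable X]setTI.
  apply: measurable_rV_coord => //; rewrite (ball_itv _ _ : _ = _).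
  exact: measurable_itv.
have -> : A = \bigcup_(qk in [set qk | box qk `<=` A]) box qk.
  apply/seteqP; split => [x Ax|x [qk /= qkA bx]]; last exact: qkA.
  have /nbhs_ballP[e /= e0 xeA] := open_nbhs_nbhs (conj oA Ax).
  have [k ke] : exists k, k.+1%:R^-1 < e / 2.
    have e20 : 0 < e / 2 by rewrite divr_gt0.
    have ie0 : 0 < (e / 2)^-1 by rewrite invr_gt0.
    exists (Num.truncn (e / 2)^-1); rewrite invf_plt ?posrE//.
    by case/andP: (truncn_itv (ltW ie0)).
  have q_ex (i : 'I_n) : exists q : rat, ball (ratr q : R) k.+1%:R^-1 (x 0 i).
    have xk : x 0 i - k.+1%:R^-1 < x 0 i + k.+1%:R^-1.
      by rewrite ltrD2l gtrN// invr_gt0.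
    have [q] := rat_in_itvoo xk.
    by rewrite in_itv/= => ?; exists q; rewrite /ball/= ltr_distl.
  have [q qP] := choice q_ex.
  exists ([ffun i => q i], k) => /=; last by move=> i _; rewrite /= ffunE; exact: qP.
  move=> y boxy; apply: xeA; split=> // j i; rewrite (ord1 j).
  have := qP i; have := boxy i Logic.I; rewrite /= ffunE /rV_coord /ball/= => h1 h2.
  rewrite (splitr e) (le_lt_trans (ler_distD (ratr (q i)) _ _))//.
  by rewrite ltrD// ?(lt_trans _ ke)// distrC.
rewrite bigcup_mkcond; apply: countable_bigcupT_measurable => [|qk].
  exact: countableP.
by case: ifP.
Qed.
End measurable_rV.

Section lebesgue_rV.
Context {R : realType}.
Local Open Scope ereal_scope.

Definition rV_cons n (p : measurableTypeR R * 'rV[R]_n) : 'rV[R]_n.+1 :=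
  \row_i (if unlift ord0 i is Some j then p.2 ord0 j else p.1).

Definition rV_uncons n (x : 'rV[R]_n.+1) : measurableTypeR R * 'rV[R]_n :=
  (rV_coord ord0 x, \row_i x ord0 (lift ord0 i)).

Lemma rV_consK n : cancel (@rV_cons n) (@rV_uncons n).
Proof.
move=> [r x]; rewrite /rV_uncons /rV_coord !mxE unlift_none; congr pair.
by apply/rowP => i; rewrite !mxE liftK.
Qed.

Lemma measurable_rV_cons n : measurable_fun setT (@rV_cons n).
Proof.
apply: measurable_fun_rVP => i.
have -> : rV_coord i \o @rV_cons n =
    fun p => if unlift ord0 i is Some j then rV_coord j p.2 else p.1.
  by apply/funext => p; rewrite /= /rV_coord mxE.
case: (unlift ord0 i) => [j|]; last exact: measurable_fst.
by apply: (measurableT_comp (measurable_rV_coord j)).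
Qed.

Lemma measurable_rV_uncons n : measurable_fun setT (@rV_uncons n).
Proof.
apply/measurable_fun_pairP; split; first exact: measurable_rV_coord.
apply: measurable_fun_rVP => i.
have -> : rV_coord i \o (snd \o @rV_uncons n) = rV_coord (lift ord0 i).
  by apply/funext => x; rewrite /= /rV_coord mxE.
exact: measurable_rV_coord.
Qed.

Section step.
Variables (n : nat) (mu : {sigma_finite_measure set 'rV[R]_n -> \bar R}).

Definition lebesgue_cons : set 'rV[R]_n.+1 -> \bar R :=
  pushforward (@lebesgue_measure R \x mu) (@rV_cons n).

Let nu0 : lebesgue_cons set0 = 0.
Proof. by rewrite /lebesgue_cons /pushforward preimage_set0 measure0. Qed.

Let nu_ge0 A : 0 <= lebesgue_cons A.
Proof. by rewrite /lebesgue_cons /pushforward measure_ge0. Qed.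

Let nu_sigma_additive : semi_sigma_additive lebesgue_cons.
Proof.
move=> F mF tF mUF; rewrite /lebesgue_cons /pushforward preimage_bigcup.
apply: measure_semi_sigma_additive.
- by move=> k; rewrite -[X in measurable X]setTI; exact: measurable_rV_cons.
- apply/trivIsetP => /= i j _ _ ij; rewrite -preimage_setI.
  by move/trivIsetP : tF => /(_ _ _ _ _ ij) ->//; rewrite preimage_set0.
- rewrite -preimage_bigcup -[X in measurable X]setTI.
  exact: measurable_rV_cons.
Qed.

HB.instance Definition _ := isMeasure.Build _ _ _
  lebesgue_cons nu0 nu_ge0 nu_sigma_additive.

Let nu_sigma_finite : sigma_finite setT lebesgue_cons.
Proof.
have /sigma_finiteP[F [UF ndF Foo]] := sigma_finiteT (@lebesgue_measure R).
have /sigma_finiteP[G [UG ndG Goo]] := sigma_finiteT mu.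
exists (fun k => @rV_uncons n @^-1` (F k `*` G k)).
  apply/esym; rewrite -subTset => x _.
  have [i _ Fi] : (\bigcup_k F k) (rV_uncons x).1 by rewrite -UF.
  have [j _ Gj] : (\bigcup_k G k) (rV_uncons x).2 by rewrite -UG.
  exists (maxn i j) => //; split.
  - by move: (rV_uncons x).1 Fi; exact/subsetPset/ndF/leq_maxl.
  - by move: (rV_uncons x).2 Gj; exact/subsetPset/ndG/leq_maxr.
move=> k; have [mF Fk] := Foo k; have [mG Gk] := Goo k; split.
  rewrite -[X in measurable X]setTI; apply: measurable_rV_uncons => //.
  exact: measurableX.
rewrite /lebesgue_cons /pushforward -comp_preimage.
have -> : @rV_uncons n \o @rV_cons n = id by apply/funext; exact: rV_consK.
by rewrite preimage_id product_measure1E// lte_mul_pinfty// ge0_fin_numE.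
Qed.

HB.instance Definition _ := Measure_isSigmaFinite.Build _ _ _
  lebesgue_cons nu_sigma_finite.
End step.

Fixpoint lebesgue_rV n : {sigma_finite_measure set 'rV[R]_n -> \bar R} :=
  if n is m.+1 then lebesgue_cons (lebesgue_rV m) else \d_(0%R : 'rV[R]_0).
End lebesgue_rV.
Arguments lebesgue_rV {R} n.

(* The space dimension is n.+1, so that it is positive. *)
Section sobolev.
Context {R : realType} {n : nat}.
Let X := 'rV[R]_n.+1.
Implicit Types (D : set X).

Definition partial (i : 'I_n.+1) (f : X -> R) : X -> R := fun x => 'D_(delta_mx 0 i) f x.

(* The elements of C_c^oo(D), extended by 0 to R^(n+1); all iterated partial
   derivatives being differentiable is C^oo. *)
Definition test_function D (phi : X -> R) : Prop :=
  (forall (s : seq 'I_n.+1) x, differentiable (foldr partial phi s) x) /\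
  exists K : set X, [/\ compact K, K `<=` D & forall x, ~ K x -> phi x = 0].

(* g is the i-th distributional derivative of f on D *)
Definition weak_partial D (i : 'I_n.+1) (f g : X -> R) : Prop :=
  forall phi, test_function D phi ->
    \int[lebesgue_rV n.+1]_(x in D) (f x * partial i phi x) =
    - \int[lebesgue_rV n.+1]_(x in D) (g x * phi x).

(* f belongs to C^1 of the closure of D *)
Definition C1_closure D (f : X -> R) : Prop :=
  {within closure D, continuous f} /\
  (forall x, D x -> differentiable f x) /\
  forall i, exists2 g : X -> R, {within closure D, continuous g} &
    forall x, D x -> g x = partial i f x.

Definition euclidean m (v : 'rV[R]_m) : R := Num.sqrt (\sum_i v 0 i ^+ 2).

(* Near each boundary point, D is, after a change of orthonormal frame, the
   part of the space below the graph of a Lipschitz function. *)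
Definition lipschitz_boundary D : Prop :=
  forall x, closure D x -> ~ D x ->
  exists (r : R) (Q : 'M[R]_n.+1) (gamma : 'rV[R]_n -> R) (L : R),
  [/\ 0 < r, Q *m Q^T = 1%:M,
     forall a b, `|gamma a - gamma b| <= L * euclidean (a - b) &
     forall y, ball x r y ->
       D y <-> ((y - x) *m Q) 0 ord_max < gamma (col' ord_max ((y - x) *m Q))].

Definition uniformly_elliptic D (a : 'I_n.+1 -> 'I_n.+1 -> X -> R) : Prop :=
  exists2 mu : R, 0 < mu & forall x (v : X), D x ->
    mu * euclidean v ^+ 2 <= \sum_k \sum_l a k l x * v 0 k * v 0 l.

Definition L2_exponent : (1 <= 2%:E :> \bar R)%E.
Proof. by rewrite lee_fin ler1n. Qed.

(* Square-integrable functions on D, not quotiented by a.e. equality: `|f| is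
   the L^2(D) seminorm, and the values outside D are irrelevant.  Operators
   between such spaces are accordingly represented by graphs. *)
Definition L2 D (mD : measurable D) :=
  LfunType (mrestr (lebesgue_rV n.+1) mD) L2_exponent.

Section L2.
Variables (D : set X) (mD : measurable D).
Local Notation E := (L2 mD).
Local Notation mu := (mrestr (lebesgue_rV n.+1) mD).

Definition L2_norm (f : E) : R := fine ('N[mu]_(2%:E)[EFin \o f])%E.

Definition L2_dot (f g : E) : R := \int[mu]_x (f x * g x).

Definition L2_eq (f g : X -> R) : Prop := ae_eq mu setT f g.

Definition L2_cvg (f_ : nat -> E) (f : E) : Prop :=
  L2_norm (f_ k - f) @[k --> \oo] --> 0.

Definition weak_gradient (f : E) (g : 'I_n.+1 -> E) : Prop :=
  forall i, weak_partial D i f (g i).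

(* graph of the gradient with domain H^1_0(D), the closure of C_c^oo(D) in
   H^1(D) *)
Definition H10_gradient (f : E) (g : 'I_n.+1 -> E) : Prop :=
  weak_gradient f g /\
  exists (phi : nat -> E) (dphi : nat -> 'I_n.+1 -> E),
  [/\ forall k, test_function D (phi k),
     forall k, weak_gradient (phi k) (dphi k),
     L2_cvg phi f & forall i, L2_cvg (fun k => dphi k i) (g i)].

Definition H10 (f : E) : Prop := exists g, H10_gradient f g.

Definition H2 (f : E) : Prop :=
  exists (g : 'I_n.+1 -> E) (h : 'I_n.+1 -> 'I_n.+1 -> E),
    weak_gradient f g /\ forall i, weak_gradient (g i) (h i).

(* graph of y |-> sum_(k, l) d_k (a_(k, l) d_l y) with domain H^2 /\ H^1_0 *)
Definition elliptic_operator (a : 'I_n.+1 -> 'I_n.+1 -> X -> R) (y w : E) :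
    Prop :=
  [/\ H2 y, H10 y & exists (g : 'I_n.+1 -> E) (d : 'I_n.+1 -> 'I_n.+1 -> E),
   [/\ weak_gradient y g,
      forall k l, weak_partial D k (fun x => a k l x * g l x) (d k l) &
      L2_eq w (\sum_k \sum_l d k l)]].

(* the eigenvalues [lam i] of -A, with multiplicities [r i] and orthonormal
   basis of eigenfunctions [phi i j], j < r i; indices start from 0, and
   [phi i j] is irrelevant for j >= r i *)
Definition eigenbasis (a : 'I_n.+1 -> 'I_n.+1 -> X -> R)
    (lam : nat -> R) (r : nat -> nat) (phi : nat -> nat -> E) : Prop :=
  [/\ 0 < lam 0%N /\ (forall i, lam i < lam i.+1),
     lam i @[i --> \oo] --> +oo,
     forall i, (0 < r i)%N,
     forall i j, (j < r i)%N ->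
       elliptic_operator a (phi i j) (- lam i *: phi i j) &
     (forall i j i' j', (j < r i)%N -> (j' < r i')%N ->
       L2_dot (phi i j) (phi i' j') = ((i == i') && (j == j'))%:R) /\
     forall f : E, L2_cvg
       (fun N => \sum_(i < N) \sum_(j < r i) L2_dot f (phi i j) *: phi i j) f].

End L2.
End sobolev.

Section mittag_leffler.
Context {R : realType}.

Definition Gamma (x : R) : R :=
  \int[lebesgue_measure]_(t in `]0, +oo[) (t `^ (x - 1) * expR (- t)).

Definition mittag_leffler (alpha z : R) : R :=
  limn (series (fun k => z ^+ k / Gamma (alpha * k%:R + 1))).

End mittag_leffler.

Section bochner.
Context {R : realType} {O : completeNormedModType R}.

Definition simple_map (s : R -> O) : Prop :=
  finite_set (range s) /\
  forall y, measurable (s @^-1` [set y] : set (measurableTypeR R)).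

Definition strongly_measurable (T : R) (z : R -> O) : Prop :=
  exists s : nat -> R -> O, (forall k, simple_map (s k)) /\
    {ae lebesgue_measure, forall t, `[0, T]%classic t -> s k t @[k --> \oo] --> z t}.

Definition bochner_sqnorm (T : R) (z : R -> O) : \bar R :=
  (\int[lebesgue_measure]_(t in `[0%R, T]) (`|z t| ^+ 2)%:E)%E.

(* L^2(0,T;O), not quotiented by a.e. equality *)
Record bochner_L2 (T : R) := BochnerL2 {
  bochner_fun :> R -> O;
  bochner_measurable : strongly_measurable T bochner_fun;
  bochner_finite : (bochner_sqnorm T bochner_fun < +oo)%E }.

Definition bochner_norm (T : R) (z : R -> O) : R :=
  Num.sqrt (fine (bochner_sqnorm T z)).

Definition bochner_dot (dotO : O -> O -> R) (T : R) (z w : bochner_L2 T) : R :=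
  \int[lebesgue_measure]_(t in `[0, T]) dotO (z t) (w t).

Definition bochner_cvg (T : R) (z_ : nat -> bochner_L2 T) (z : bochner_L2 T) :
    Prop :=
  bochner_norm T (fun t => z_ k t - z t) @[k --> \oo] --> 0.

End bochner.
Arguments bochner_L2 {R} O T.

Section graphs.
Context {R : realType} {Y Z : Type}.
Implicit Types G : Z -> Y -> Prop.

(* The graph of the adjoint of the operator with graph G; it is the graph of
   an operator exactly when the domain of G is dense. *)
Definition adjoint (dotZ : Z -> Z -> R) (dotY : Y -> Y -> R) G :
    Y -> Z -> Prop :=
  fun u w => forall z y, G z y -> dotY y u = dotZ z w.

Definition in_image G (y : Y) : Prop := exists z, G z y.

End graphs.

Section system.
Context {R : realType} {n : nat} {O : completeNormedModType R}.
Variables (D : set 'rV[R]_n.+1) (mD : measurable D).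
Local Notation E := (L2 mD).

(* A linear map into O with domain a subspace of E, compatible with a.e.
   equality. *)
Definition linear_operator (dom : set E) (C : E -> O) : Prop :=
  [/\ dom 0,
     forall (c : R) f g, dom f -> dom g ->
       dom (c *: f + g) /\ C (c *: f + g) = c *: C f + C g &
     forall f g : E, L2_eq mD f g -> dom f -> dom g /\ C f = C g].

Variables (alpha T : R) (lam : nat -> R) (r : nat -> nat)
  (phi : nat -> nat -> E) (domC : set E) (C : E -> O).

(* graph of S_alpha(t) *)
Definition mild_solution (t : R) (u0 u : E) : Prop :=
  L2_cvg (fun N => \sum_(i < N) mittag_leffler alpha (- lam i * t `^ alpha) *:
    \sum_(j < r i) L2_dot u0 (phi i j) *: phi i j) u.

(* graph of K_alpha, with its maximal domain: the u0 for which S_alpha(t) u0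
   is in the domain of C for a.e. t and t |-> C S_alpha(t) u0 is in
   L^2(0,T;O) *)
Definition observability_operator (u0 : E) (z : bochner_L2 O T) : Prop :=
  {ae lebesgue_measure, forall t, `[0, T]%classic t ->
    exists u, [/\ mild_solution t u0 u, domC u & z t = C u]}.

Definition admissible (a : 'I_n.+1 -> 'I_n.+1 -> 'rV[R]_n.+1 -> R) : Prop :=
  exists2 M : R, 0 < M & forall v w : E, elliptic_operator a v w ->
    exists2 z, observability_operator v z &
      bochner_norm T z ^+ 2 <= M * L2_norm v ^+ 2.

Variables (dotO : O -> O -> R) (om : set 'rV[R]_n.+1) (mom : measurable om).
Local Notation Y := ('I_n.+1 -> L2 mom).

Definition L2n_dot (u v : Y) : R := \sum_i L2_dot (u i) (v i).

Definition L2n_norm (u : Y) : R := Num.sqrt (\sum_i L2_norm (u i) ^+ 2).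

Definition L2n_cvg (u_ : nat -> Y) (u : Y) : Prop :=
  L2n_norm (fun i => u_ k i - u i) @[k --> \oo] --> 0.

(* graph of chi_om^n : E^n -> (L^2(om))^n *)
Definition restriction (g : 'I_n.+1 -> E) (y : Y) : Prop :=
  forall i, L2_eq mom (g i) (y i).

(* graph of H_alpha = chi_om^n \o grad \o K_alpha^*; in particular z is in
   the domain iff K_alpha^* z is in H^1_0(D) *)
Definition H_operator (z : bochner_L2 O T) (y : Y) : Prop :=
  exists (p : E) (g : 'I_n.+1 -> E),
  [/\ adjoint (@L2_dot _ _ _ mD) (bochner_dot dotO (T:=T))
        observability_operator z p, H10_gradient p g & restriction g y].

Definition H_adjoint : Y -> bochner_L2 O T -> Prop :=
  adjoint (bochner_dot dotO (T:=T)) L2n_dot H_operator.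

Definition exactly_G_observable : Prop := forall y, in_image H_operator y.

Definition trivial_kernel_H_adjoint : Prop := forall u,
  (exists2 w : bochner_L2 O T, bochner_norm T w = 0 & H_adjoint u w) <->
  L2n_norm u = 0.

Definition closed_image_H : Prop := forall (y_ : nat -> Y) y,
  (forall k, in_image H_operator (y_ k)) -> L2n_cvg y_ y ->
  in_image H_operator y.

(* Elements u outside the domain of H_alpha^* are those for which the norm of
   H_alpha^* u is to be read as +oo. *)
Definition H_adjoint_bounded_below : Prop := exists2 c : R, 0 < c &
  forall u w, H_adjoint u w -> L2n_norm u <= c * bochner_norm T w.

(* Not automatic: chi_om^n \o grad with domain H^1_0(D) is closable but in
   general not closed when om is smaller than D. *)
Definition closed_graph_H : Prop :=
  forall (z_ : nat -> bochner_L2 O T) (y_ : nat -> Y) z y,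
  (forall k, H_operator (z_ k) (y_ k)) -> bochner_cvg z_ z -> L2n_cvg y_ y ->
  H_operator z y.

End system.

(* Main.v *)
Require Import Defs.
From HB Require Import structures.
From mathcomp Require Import all_boot all_order all_algebra.
From mathcomp Require Import all_classical all_reals all_analysis.
From mathcomp Require Import measurable_realfun ring lra.
Set Implicit Arguments.
Unset Strict Implicit.
Unset Printing Implicit Defensive.
Import Order.TTheory GRing.Theory Num.Theory.
Import numFieldNormedType.Exports.
Local Open Scope classical_set_scope.
Local Open Scope ring_scope.

(** Two facts drive the proof: [H_operator] is a linear relation, and both
    [L2 mom] to the power [n.+1] and the Bochner space are complete.

    Linearity holds because each ingredient of [H_operator] (an adjoint, the
    gradient on H^1_0, a restriction) is defined by identities that are linear
    in the integrands.  For the weak gradient this requires the products with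
    test functions to be integrable, which follows from the boundedness of the
    domain ([integrable_L2M], [H10_gradient_lin]).

    Write H for the relation.

    - If H is onto, an element of the kernel of H^* is orthogonal to the whole
      space.  Conversely the projection onto the closed image of H leaves a
      remainder orthogonal to the image, i.e. in the kernel of H^*
      ([closed_subspace_full]).

    - If H is onto, the vectors u with H^* u in the unit ball are pointwise
      bounded: when y = H z, one has <y, u> = <z, H^* u>, of modulus at most
      the norm of z.  The uniform boundedness principle bounds their norms
      ([uniform_boundedness]), and scaling gives the inequality.  The closed
      range theorem would not do here, since H may fail to be closed.

    - If H is closed and H^* is bounded below, then projecting (0, y) onto the
      graph of H, for a weighted product norm, is a Tikhonov regularization of
      H z = y.  The optimality condition says that the residual, up to the
      weight, belongs to the domain of H^*, so that the lower bound makes the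
      residual small compared with y while z stays bounded
      ([approximate_preimage]).  Iterating on the residuals produces a
      geometric series whose sum is an exact preimage, because H is closed
      ([linear_relation_onto]).

    The functional analysis is done for subspaces with a positive semidefinite
    form, because square integrable functions are not identified almost
    everywhere.  Completeness of the two spaces is the Riesz-Fischer theorem
    ([rapid_ae_cvg], [rapid_sqdist_limit]); in the Bochner space the limit has
    to be strongly measurable, which is obtained by replacing the given Cauchy
    sequence by a nearby sequence of simple maps ([simple_fun_dense]). *)

(** * Geometric decay *)

Section rapid.
Context {R : realType}.
Implicit Types (a b c : R).

Lemma le0_rapid a c : (forall k, a <= c / 8 ^+ k) -> a <= 0.
Proof.
move=> ac; rewrite leNgt; apply/negP => a0.
have c0 : 0 < c by have := ac 0%N; rewrite expr0 divr1; exact/lt_le_trans.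
have := ac (Num.truncn (c / a)).+1; apply/negP; rewrite -ltNge.
rewrite ltr_pdivrMr ?exprn_gt0// mulrC -ltr_pdivrMr//.
have /andP[_ h] := truncn_itv (ltW (divr_gt0 c0 a0)).
apply: (lt_trans h); rewrite -natrX ltr_nat; exact: ltn_expl.
Qed.

Lemma rapidS k c : c / 8 ^+ k.+1 = c / 8 ^+ k / 8.
Proof. by rewrite exprSr invfM mulrA. Qed.

Lemma rapid_ge0 k : 0 <= (8 ^+ k)^-1 :> R.
Proof. by rewrite invr_ge0 exprn_ge0. Qed.

Lemma rapid_cvg0 (u : nat -> R) c : (forall k, 0 <= u k) ->
  (forall k, u k ^+ 2 <= c / 8 ^+ k) -> u @ \oo --> 0.
Proof.
move=> u0 uc.
have c0 : 0 <= c by have := uc 0%N; rewrite expr0 divr1; exact/le_trans/sqr_ge0.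
have half_lt1 : `|2^-1| < 1 :> R by rewrite ger0_norm// invf_lt1// ltr1n.
apply: (squeeze_cvgr _ (cvg_cst 0) (cvg_geometric (Num.sqrt c) half_lt1)).
apply: nearW => k; rewrite u0/= -ler_sqr ?nnegrE ?mulr_ge0 ?sqrtr_ge0 ?exprn_ge0//.
rewrite exprMn sqr_sqrtr// (le_trans (uc k))// -exprM mulnC exprM exprVn.
rewrite ler_wpM2l// exprVn lef_pV2 ?posrE ?exprn_gt0// lerXn2r ?nnegrE//.
by rewrite -natrX ler_nat.
Qed.

(** A quadratic polynomial that is nonnegative everywhere has a nonpositive
    discriminant. *)
Lemma quadratic_discriminant (a b c : R) : 0 <= c ->
  (forall t, 0 <= a - 2 * t * b + t ^+ 2 * c) -> b ^+ 2 <= a * c.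
Proof.
rewrite le_eqVlt => /predU1P[<- h|c0 h].
  (* the polynomial is affine, and takes a negative value unless [b = 0] *)
  have a0 : 0 <= a by have := h 0; lra.
  have [->|b0] := eqVneq b 0; first by nra.
  have := h ((a + 1) / b).
  suff -> : a - 2 * ((a + 1) / b) * b + ((a + 1) / b) ^+ 2 * 0 = a - 2 * (a + 1) by lra.
  by field.
have := h (b / c).
suff -> : a - 2 * (b / c) * b + (b / c) ^+ 2 * c = (a * c - b ^+ 2) / c.
  by rewrite pmulr_lge0 ?invr_gt0// subr_ge0.
by field; rewrite gt_eqF.
Qed.

End rapid.

(** * Subspaces with a semidefinite inner product *)

Definition linear_subspace {R : realType} {V : lmodType R} (S : set V) : Prop :=
  S 0 /\ forall (a : R) x y, S x -> S y -> S (a *: x + y).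

(** The carrier is a subspace [S] of an ambient space because square integrable
    functions sit inside all functions; the form is only semidefinite because
    functions that agree almost everywhere are not identified. *)
Record pre_hilbert {R : realType} {V : lmodType R} (S : set V)
    (dot : V -> V -> R) : Prop := PreHilbert {
  ph_subspace : linear_subspace S;
  ph_sym : forall x y, S x -> S y -> dot x y = dot y x;
  ph_lin : forall a x y z, S x -> S y -> S z ->
    dot (a *: x + y) z = a * dot x z + dot y z;
  ph_ge0 : forall x, S x -> 0 <= dot x x }.

(** Passing to subsequences, completeness only has to be tested on sequences
    with geometrically decreasing steps.  The ratio 8 of the squared steps is
    larger than 2, so that the steps can be summed with the inequality
    [q (x + y) <= 2 * q x + 2 * q y] and without square roots, and larger than
    4, so that the squared steps stay summable with the weights [4 ^+ k] that
    give convergence almost everywhere in spaces of functions. *)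
Record semi_hilbert {R : realType} {V : lmodType R} (S : set V)
    (dot : V -> V -> R) : Prop := SemiHilbert {
  sh_pre :> pre_hilbert S dot;
  sh_complete : forall (x : nat -> V) (M : R), (forall k, S (x k)) ->
    (forall k, dot (x k.+1 - x k) (x k.+1 - x k) <= M / 8 ^+ k) ->
    exists z, S z /\
      exists C, forall k, dot (x k - z) (x k - z) <= C / 8 ^+ k }.

Definition rapidly_closed {R : realType} {V : lmodType R}
    (dot : V -> V -> R) (S G : set V) : Prop :=
  forall (x : nat -> V) (z : V) (C : R), (forall k, G (x k)) -> S z ->
    (forall k, dot (x k - z) (x k - z) <= C / 8 ^+ k) -> G z.

Section subspace.
Context {R : realType} {V : lmodType R} {S : set V}.
Hypothesis lS : linear_subspace S.

Lemma subspaceZ (a : R) x : S x -> S (a *: x).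
Proof. by move=> Sx; have := lS.2 a _ _ Sx lS.1; rewrite addr0. Qed.

Lemma subspaceD x y : S x -> S y -> S (x + y).
Proof. by move=> Sx Sy; have := lS.2 1 _ _ Sx Sy; rewrite scale1r. Qed.

Lemma subspaceB x y : S x -> S y -> S (x - y).
Proof. by move=> Sx Sy; rewrite -scaleN1r addrC; exact: lS.2. Qed.

End subspace.

Section pre_hilbert_theory.
Context {R : realType} {V : lmodType R} {S : set V} {dot : V -> V -> R}.
Hypothesis phS : pre_hilbert S dot.
Let lS := ph_subspace phS.
Let sD := subspaceD lS.
Let sB := subspaceB lS.
Let sZ := subspaceZ lS.
Local Notation q x := (dot x x).

Lemma dotDl x y z : S x -> S y -> S z -> dot (x + y) z = dot x z + dot y z.
Proof. by move=> *; rewrite -[x in LHS]scale1r (ph_lin phS)// mul1r. Qed.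

Lemma dot0l z : S z -> dot 0 z = 0.
Proof.
move=> Sz; have := dotDl lS.1 lS.1 Sz; rewrite addr0; lra.
Qed.

Lemma dotZl a x z : S x -> S z -> dot (a *: x) z = a * dot x z.
Proof.
move=> Sx Sz; have := ph_lin phS a Sx lS.1 Sz.
by rewrite addr0 dot0l// addr0.
Qed.

Lemma dotBl x y z : S x -> S y -> S z -> dot (x - y) z = dot x z - dot y z.
Proof.
by move=> Sx Sy Sz; rewrite -scaleN1r addrC (ph_lin phS)// mulN1r addrC.
Qed.

Lemma dotZr a x z : S x -> S z -> dot x (a *: z) = a * dot x z.
Proof.
by move=> Sx Sz; rewrite (ph_sym phS) ?dotZl ?(ph_sym phS Sz)//; exact: sZ.
Qed.

Lemma dotDr x y z : S x -> S y -> S z -> dot z (x + y) = dot z x + dot z y.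
Proof.
move=> Sx Sy Sz; rewrite (ph_sym phS) ?dotDl//; last exact: sD.
by congr (_ + _); rewrite (ph_sym phS).
Qed.

Lemma dotBr x y z : S x -> S y -> S z -> dot z (x - y) = dot z x - dot z y.
Proof.
move=> Sx Sy Sz; rewrite (ph_sym phS) ?dotBl//; last exact: sB.
by congr (_ - _); rewrite (ph_sym phS).
Qed.

Lemma sqD x y : S x -> S y -> q (x + y) = q x + 2 * dot x y + q y.
Proof.
move=> Sx Sy; have Sxy := sD Sx Sy.
by rewrite dotDl ?dotDr// (ph_sym phS Sy Sx); ring.
Qed.

Lemma sqB x y : S x -> S y -> q (x - y) = q x - 2 * dot x y + q y.
Proof.
move=> Sx Sy; have Sxy := sB Sx Sy.
by rewrite dotBl ?dotBr// (ph_sym phS Sy Sx); ring.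
Qed.

Lemma sqZ a x : S x -> q (a *: x) = a ^+ 2 * q x.
Proof. by move=> Sx; rewrite dotZl ?dotZr; [ring|exact: Sx..|exact: sZ]. Qed.

Lemma sqBC x y : S x -> S y -> q (x - y) = q (y - x).
Proof. by move=> Sx Sy; rewrite !sqB// (ph_sym phS Sx Sy); ring. Qed.

Lemma sqD_le x y : S x -> S y -> q (x + y) <= 2 * q x + 2 * q y.
Proof.
move=> Sx Sy; have := ph_ge0 phS (sB Sx Sy).
by rewrite sqB ?sqD//; lra.
Qed.

Lemma cauchy_schwarz x y : S x -> S y -> dot x y ^+ 2 <= q x * q y.
Proof.
move=> Sx Sy; apply: quadratic_discriminant => [|t]; first exact: (ph_ge0 phS).
have := ph_ge0 phS (sB Sx (sZ t Sy)).
by rewrite sqB ?sqZ ?dotZr//; [lra|exact: sZ].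
Qed.

(** The constant 3 is stable under one step of the recursion:
    [2 + 2 * 3 / 8 <= 3]. *)
Lemma rapid_tail (x : nat -> V) (M : R) : (forall k, S (x k)) ->
    (forall k, q (x k.+1 - x k) <= M / 8 ^+ k) ->
  forall j k, q (x (k + j)%N - x k) <= 3 * M / 8 ^+ k.
Proof.
move=> Sx xM; elim=> [|j ih] k.
  have := xM k; have := ph_ge0 phS (sB (Sx k.+1) (Sx k)).
  by rewrite addn0 subrr (dot0l lS.1) -mulrA; lra.
have -> : x (k + j.+1)%N - x k = (x (k.+1 + j)%N - x k.+1) + (x k.+1 - x k).
  by rewrite addrA subrK addSnnS.
apply: (le_trans (sqD_le (sB (Sx _) (Sx _)) (sB (Sx _) (Sx _)))).
have := ih k.+1; have := xM k; have := ph_ge0 phS (sB (Sx k.+1) (Sx k)).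
by rewrite rapidS; lra.
Qed.

(** The tail estimate passes to the limit with a constant that depends on the
    steps only, whatever the constant [C] witnessing the convergence. *)
Lemma rapid_limit_tail (x : nat -> V) z (M C : R) : (forall k, S (x k)) -> S z ->
    (forall k, q (x k.+1 - x k) <= M / 8 ^+ k) ->
    (forall k, q (x k - z) <= C / 8 ^+ k) ->
  forall k, q (x k - z) <= 6 * M / 8 ^+ k.
Proof.
move=> Sx Sz xM xC k; rewrite -subr_le0; apply: (@le0_rapid _ _ (2 * C)) => j.
have -> : x k - z = (x k - x (k + j)%N) + (x (k + j)%N - z).
  by rewrite addrA subrK.
rewrite lerBlDr.
apply: (le_trans (sqD_le (sB (Sx _) (Sx _)) (sB (Sx _) Sz))).
have := rapid_tail Sx xM j k; rewrite sqBC// => h1.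
have h2 : q (x (k + j)%N - z) <= C / 8 ^+ j.
  have C0 : 0 <= C.
    by have := xC 0%N; rewrite expr0 divr1; exact/le_trans/(ph_ge0 phS)/sB.
  apply: (le_trans (xC _)); rewrite ler_wpM2l// lef_pV2 ?posrE ?exprn_gt0//.
  by rewrite ler_eXn2l ?leq_addl// ltr1n.
by move: h1 h2; rewrite -!mulrA; lra.
Qed.

End pre_hilbert_theory.

(** * Projections and uniform boundedness *)

Section semi_hilbert_theory.
Context {R : realType} {V : lmodType R} {S : set V} {dot : V -> V -> R}.
Hypothesis shS : semi_hilbert S dot.
Let lS := ph_subspace shS.
Let sD := subspaceD lS.
Let sB := subspaceB lS.
Let sZ := subspaceZ lS.
Local Notation q x := (dot x x).

Section projection.
Variable G : set V.
Hypotheses (GS : G `<=` S) (lG : linear_subspace G) (cG : rapidly_closed dot S G).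

(** A minimizing sequence for the distance from [y] to [G] is Cauchy by the
    parallelogram identity.  Orthogonality is read off along the sequence:
    moving from [x k] in the direction [g] cannot decrease the squared distance
    by more than its defect [1 / 8 ^+ k], and this bounds [dot (y - x k) g]. *)
Lemma projection y : S y -> exists2 p, G p & forall g, G g -> dot (y - p) g = 0.
Proof.
move=> Sy; pose D := [set q (y - g) | g in G].
have D0 : has_inf D.
  split; first by exists (q (y - 0)); exists 0 => //; exact: lG.1.
  by exists 0 => _ [g Gg <-]; exact/(ph_ge0 shS)/sB/GS.
have lbD g : G g -> inf D <= q (y - g).
  by move=> Gg; apply: ge_inf; [exact: D0.2|exists g].
have /choice[x xP] k : exists g, G g /\ q (y - g) <= inf D + 1 / 8 ^+ k.
  have e0 : 0 < 1 / 8 ^+ k :> R by rewrite divr_gt0// exprn_gt0.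
  by have [_ [g Gg <-] /ltW] := inf_adherent e0 D0; exists g.
have Gx k := (xP k).1; have xq k := (xP k).2; have Sx k := GS (Gx k).
have [|z [Sz [C zC]]] := sh_complete shS (M := 4) Sx.
  move=> k; pose m := 2^-1 *: (x k + x k.+1).
  have Gm : G m by apply: (subspaceZ lG); exact: (subspaceD lG).
  have Sm := GS Gm; have lm := lbD _ Gm.
  have ym : dot y m = 2^-1 * (dot y (x k) + dot y (x k.+1)).
    by rewrite /m (dotZr shS) ?(dotDr shS)//; exact: sD.
  have mm : q m = 2^-1 ^+ 2 * (q (x k) + 2 * dot (x k) (x k.+1) + q (x k.+1)).
    by rewrite /m (sqZ shS) ?(sqD shS)//; exact: sD.
  (* the parallelogram identity around the midpoint [m] *)
  have : q (x k.+1 - x k) = 2 * q (y - x k) + 2 * q (y - x k.+1) - 4 * q (y - m).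
    rewrite (sqB shS Sy Sm) (sqB shS (Sx _) (Sx _)) !(sqB shS Sy (Sx _)) ym mm.
    by rewrite (ph_sym shS (Sx k.+1) (Sx k)); field.
  have := xq k; have := xq k.+1; rewrite rapidS !div1r.
  by have := rapid_ge0 (R:=R) k; lra.
have Gz : G z by exact: cG zC.
exists z => // g Gg; have Sg := GS Gg.
have yxg k : dot (y - x k) g ^+ 2 <= 1 / 8 ^+ k * q g.
  apply: quadratic_discriminant => [|t]; first exact: (ph_ge0 shS).
  have := lbD _ (subspaceD lG (Gx k) (subspaceZ lG t Gg)).
  rewrite opprD addrA (sqB shS); [|exact: sB|exact: sZ].
  by rewrite (sqZ shS) ?(dotZr shS)//; [have := xq k; lra|exact: sB].
apply/eqP; rewrite -sqrf_eq0 eq_le sqr_ge0 andbT.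
apply: (@le0_rapid _ _ ((2 + 2 * C) * q g)) => k.
have -> : y - z = (y - x k) + (x k - z) by rewrite addrA subrK.
rewrite (dotDl shS)//; [|exact: sB..].
have := yxg k; have := cauchy_schwarz shS (sB (Sx k) Sz) Sg.
have : q (x k - z) * q g <= C / 8 ^+ k * q g.
  by rewrite ler_wpM2r//; exact: (ph_ge0 shS).
move: (dot _ g) (dot _ g) (q g) (_ ^-1) => b a c e ? ? ?.
have := sqr_ge0 (a - b); lra.
Qed.

Lemma closed_subspace_full :
  (forall u, S u -> (forall g, G g -> dot u g = 0) -> q u = 0) -> S `<=` G.
Proof.
move=> ker y Sy; have [p Gp py] := projection Sy; have Sp := GS Gp.
have yp : q (y - p) = 0 by apply: ker => //; exact: sB.
apply: (cG (x := fun=> p) (C := 0) (fun=> Gp) Sy) => k.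
by rewrite (sqBC shS)// yp mul0r.
Qed.

End projection.

(** The elementary gliding hump argument of Sokal: if the vectors [u k] of [U]
    have squared norms above [64 ^+ k], the partial sums of steps parallel to
    [u k], with signs chosen so that each step does not decrease
    [`|dot x (u k)|], converge to a point at which [U] is not bounded, since the
    tail after step [k] is too short to undo that step. *)
Lemma uniform_boundedness (U : set V) : U `<=` S ->
  (forall y, S y -> exists c, forall u, U u -> dot y u ^+ 2 <= c) ->
  exists2 c, 0 < c & forall u, U u -> q u <= c.
Proof.
move=> US Ubd; apply: contrapT => Uunbd.
have /choice[u uP] k : exists u, U u /\ 64 ^+ k < q u.
  apply: contrapT => nu; apply: Uunbd; exists (64 ^+ k); first exact: exprn_gt0.
  move=> u Uu; rewrite leNgt; apply/negP => ku; apply: nu; by exists u.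
have Uu k := (uP k).1; have uq k := (uP k).2; have Su k := US _ (Uu k).
have q0 k : 0 < q (u k) by apply: lt_trans (uq k); exact: exprn_gt0.
pose a k := Num.sqrt ((8 ^+ k)^-1 / q (u k)).
have aq k : a k ^+ 2 * q (u k) = (8 ^+ k)^-1.
  by rewrite sqr_sqrtr ?divr_ge0 ?rapid_ge0 ?(ltW (q0 _))// divfK// gt_eqF.
pose step k x := if 0 <= dot x (u k) then x + a k *: u k else x - a k *: u k.
pose x := fix x k := if k is j.+1 then step j (x j) else 0.
have Sx k : S (x k).
  elim: k => [|k ih] /=; first exact: lS.1.
  by rewrite /step; case: ifP => _; [apply: sD|apply: sB] => //; exact: sZ.
have xq k : q (x k.+1 - x k) <= 1 / 8 ^+ k.
  rewrite /= /step; case: ifP => _.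
    by rewrite addrAC subrr add0r (sqZ shS)// aq div1r.
  by rewrite addrAC subrr add0r -scaleNr (sqZ shS)// sqrrN aq div1r.
have xu k : (8 ^+ k)^-1 * q (u k) <= dot (x k.+1) (u k) ^+ 2.
  have -> : (8 ^+ k)^-1 * q (u k) = (a k * q (u k)) ^+ 2.
    by rewrite -aq; ring.
  have h0 : 0 <= a k * q (u k) by rewrite mulr_ge0 ?sqrtr_ge0 ?ltW.
  rewrite /= /step; case: ifPn => [h|].
    rewrite (dotDl shS) ?(dotZl shS)//; last exact: sZ.
    by rewrite ler_sqr ?nnegrE ?addr_ge0// lerDr.
  rewrite -ltNge (dotBl shS) ?(dotZl shS)//; last exact: sZ.
  by move/ltW => h; rewrite -[leRHS]sqrrN opprB ler_sqr ?nnegrE ?subr_ge0; lra.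
have [z [Sz [C zC]]] := sh_complete shS Sx xq.
have tail := rapid_limit_tail shS Sx Sz xq zC.
have [c cP] := Ubd z Sz.
(* [A] below is the pairing of [u k] with [x k.+1], [B] that with the tail:
   [B ^+ 2] is at most 3/4 of the lower bound of [A ^+ 2], and
   [A ^+ 2 <= 7 * (A - B) ^+ 2 + (7 / 6) * B ^+ 2] *)
have zu k : 8 ^+ k <= 56 * c.
  have zE : z = x k.+1 - (x k.+1 - z) by rewrite opprB addrC subrK.
  have := cP _ (Uu k); rewrite {1}zE (dotBl shS)//; last exact: sB.
  have := cauchy_schwarz shS (sB (Sx k.+1) Sz) (Su k).
  have : q (x k.+1 - z) * q (u k) <= 6 / 8 ^+ k.+1 * q (u k).
    by apply: ler_wpM2r; [exact/ltW|rewrite -[6]mulr1; exact: tail].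
  rewrite rapidS; have := xu k.
  have : 8 ^+ k <= (8 ^+ k)^-1 * q (u k).
    rewrite mulrC ler_pdivlMr ?exprn_gt0// -exprMn ltW// (le_lt_trans _ (uq k))//.
    by rewrite -natrM.
  move: (dot (x k.+1 - z) (x k.+1 - z)) (dot (x k.+1 - z) (u k)).
  move: (dot (x k.+1) (u k)) (q (u k)) (8 ^- k) => A Q e N B h1 h2 h3 h4 h5.
  have := sqr_ge0 (6 * A - 7 * B); lra.
suff : 1 <= 0 :> R by rewrite ler10.
apply: (@le0_rapid _ _ (56 * c)) => k; rewrite ler_pdivlMr ?exprn_gt0// mul1r.
exact: zu.
Qed.

End semi_hilbert_theory.

(** * Products of spaces *)

Section product.
Context {R : realType} {V1 V2 : lmodType R} {S1 : set V1} {S2 : set V2}.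
Context {dot1 : V1 -> V1 -> R} {dot2 : V2 -> V2 -> R}.
Hypotheses (sh1 : semi_hilbert S1 dot1) (sh2 : semi_hilbert S2 dot2).

Definition dot_prod (e : R) (x y : V1 * V2) : R :=
  e * dot1 x.1 y.1 + dot2 x.2 y.2.

Lemma semi_hilbert_prod e : 0 < e -> semi_hilbert (S1 `*` S2) (dot_prod e).
Proof.
move=> e0; split; first split.
- split=> [|a x y [x1 x2] [y1 y2]].
    by split; [exact: (ph_subspace sh1).1|exact: (ph_subspace sh2).1].
  by split; [exact: (ph_subspace sh1).2|exact: (ph_subspace sh2).2].
- by move=> x y [x1 x2] [y1 y2]; rewrite /dot_prod (ph_sym sh1)// (ph_sym sh2).
- move=> a x y z [x1 x2] [y1 y2] [z1 z2].
  by rewrite /dot_prod (ph_lin sh1)// (ph_lin sh2)//; ring.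
- move=> x [x1 x2]; apply: addr_ge0; last exact: (ph_ge0 sh2).
  by apply: mulr_ge0; [exact: ltW|exact: (ph_ge0 sh1)].
move=> x M Sx xM; have Sx1 k := (Sx k).1; have Sx2 k := (Sx k).2.
have n1 k := ph_ge0 sh1 (subspaceB (ph_subspace sh1) (Sx1 k.+1) (Sx1 k)).
have n2 k := ph_ge0 sh2 (subspaceB (ph_subspace sh2) (Sx2 k.+1) (Sx2 k)).
have [|z1 [Sz1 [C1 h1]]] := sh_complete sh1 (M := M / e) Sx1.
  move=> k; rewrite mulrAC ler_pdivlMr//.
  by have := xM k; have := n2 k; rewrite /dot_prod /=; lra.
have [|z2 [Sz2 [C2 h2]]] := sh_complete sh2 (M := M) Sx2.
  move=> k; have := xM k.
  have : 0 <= e * dot1 ((x k.+1).1 - (x k).1) ((x k.+1).1 - (x k).1).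
    by rewrite mulr_ge0// (ltW e0).
  by rewrite /dot_prod /=; lra.
exists (z1, z2); split=> //; exists (e * C1 + C2) => k.
rewrite /dot_prod /= [leRHS]mulrDl -mulrA lerD//.
by rewrite ler_wpM2l// ltW.
Qed.

End product.

Section sum.
Context {R : realType} {V : lmodType R} {S : set V} {dot : V -> V -> R}.
Hypothesis shS : semi_hilbert S dot.
Variable m : nat.

Lemma semi_hilbert_sum :
  semi_hilbert [set x : 'I_m -> V | forall i, S (x i)]
    (fun x y => \sum_i dot (x i) (y i)).
Proof.
have lS := ph_subspace shS; split; first split.
- split=> [i|a x y Sx Sy i]; first exact: lS.1.
  exact: lS.2.
- by move=> x y Sx Sy; apply: eq_bigr => i _; exact: (ph_sym shS).
- move=> a x y z Sx Sy Sz; rewrite mulr_sumr -big_split; apply: eq_bigr => i _.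
  exact: (ph_lin shS).
- by move=> x Sx; apply: sumr_ge0 => i _; exact: (ph_ge0 shS).
move=> x M Sx xM.
have cvg_i i : exists zC : V * R,
    S zC.1 /\ forall k, dot (x k i - zC.1) (x k i - zC.1) <= zC.2 / 8 ^+ k.
  have [||z [Sz [C zC]]] := sh_complete shS (x := fun k => x k i) (M := M).
  - by move=> k; exact: Sx.
  - move=> k; apply: le_trans (xM k); rewrite (bigD1 i)//= lerDl sumr_ge0// => j _.
    by apply/(ph_ge0 shS)/(subspaceB lS); exact: Sx.
  by exists (z, C).
have [zC zCP] := choice cvg_i.
exists (fun i => (zC i).1); split=> [i|]; first exact: (zCP i).1.
exists (\sum_i (zC i).2) => k; rewrite mulr_suml; apply: ler_sum => i _.
exact: (zCP i).2.
Qed.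

End sum.

(** * Closed linear relations whose adjoint is bounded below *)

Section linear_relation.
Context {R : realType} {V1 V2 : lmodType R} {S1 : set V1} {S2 : set V2}.
Context {dot1 : V1 -> V1 -> R} {dot2 : V2 -> V2 -> R}.
Hypotheses (sh1 : semi_hilbert S1 dot1) (sh2 : semi_hilbert S2 dot2).
Variable G : set (V1 * V2).
Hypotheses (GS : G `<=` S1 `*` S2) (lG : linear_subspace G).
Hypothesis cG : forall (x : nat -> V1 * V2) z C, (forall k, G (x k)) ->
  S1 z.1 -> S2 z.2 ->
  (forall k, dot1 ((x k).1 - z.1) ((x k).1 - z.1) <= C / 8 ^+ k) ->
  (forall k, dot2 ((x k).2 - z.2) ((x k).2 - z.2) <= C / 8 ^+ k) -> G z.
Variable c : R.
Hypotheses (c_gt0 : 0 < c) (adj_below : forall u w, S2 u -> S1 w ->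
  (forall g, G g -> dot2 g.2 u = dot1 g.1 w) -> dot2 u u <= c * dot1 w w).
Let l1 := ph_subspace sh1.
Let l2 := ph_subspace sh2.

Let closed_prod e : 0 < e ->
  rapidly_closed (dot_prod (dot1:=dot1) (dot2:=dot2) e) (S1 `*` S2) G.
Proof.
move=> e0 x z C Gx [Sz1 Sz2] xC.
have d1 k : 0 <= dot1 ((x k).1 - z.1) ((x k).1 - z.1).
  by apply/(ph_ge0 sh1)/(subspaceB l1) => //; exact: (GS (Gx k)).1.
have d2 k : 0 <= dot2 ((x k).2 - z.2) ((x k).2 - z.2).
  by apply/(ph_ge0 sh2)/(subspaceB l2) => //; exact: (GS (Gx k)).2.
have C0 : 0 <= C.
  have := xC 0%N; rewrite expr0 divr1; apply: le_trans.
  by apply: addr_ge0; [apply: mulr_ge0; [exact: ltW|exact: d1]|exact: d2].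
have Ce : 0 <= C / e by rewrite divr_ge0// ltW.
apply: (cG (x := x) (C := C / e + C)) => // k.
  rewrite mulrDl; apply: ler_wpDr; first by rewrite mulr_ge0 ?rapid_ge0.
  rewrite mulrAC ler_pdivlMr//.
  by have := xC k; have := d2 k; rewrite /dot_prod/=; lra.
rewrite mulrDl; apply: ler_wpDl; first by rewrite mulr_ge0 ?rapid_ge0.
apply: le_trans (xC k); rewrite /dot_prod/= lerDr.
by apply: mulr_ge0; [exact: ltW|exact: d1].
Qed.

(** The projection [p] of [(0, y)] onto [G] minimizes
    [e * dot1 g.1 g.1 + dot2 (y - g.2) (y - g.2)] over [g] in [G].  Being
    orthogonal to [G] means that the adjoint relates [y - p.2] to [e *: p.1],
    whence [dot2 (y - p.2) (y - p.2) <= c * e ^+ 2 * dot1 p.1 p.1], while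
    orthogonality to [p] itself bounds [e * dot1 p.1 p.1] by [dot2 y y / 2]. *)
Lemma approximate_preimage y : S2 y -> exists g, [/\ G g,
  dot2 (y - g.2) (y - g.2) <= dot2 y y / 8 & dot1 g.1 g.1 <= 2 * c * dot2 y y].
Proof.
move=> Sy.
(* this weight makes the residual at most [dot2 y y / 8] *)
pose e := (4 * c)^-1.
have e0 : 0 < e by rewrite invr_gt0 mulr_gt0.
have [p Gp pP] := projection (semi_hilbert_prod sh1 sh2 e0) GS lG (closed_prod e0)
  (conj l1.1 Sy : (S1 `*` S2) (0, y)).
have [Sp1 Sp2] := GS Gp; have Syp := subspaceB l2 Sy Sp2.
have orth g : G g -> dot2 (y - p.2) g.2 = e * dot1 p.1 g.1.
  move=> Gg; have [Sg1 Sg2] := GS Gg; have := pP g Gg.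
  rewrite /dot_prod/= (dotBl sh1 l1.1 Sp1 Sg1) (dot0l sh1 Sg1); lra.
have : dot2 (y - p.2) (y - p.2) <= c * dot1 (e *: p.1) (e *: p.1).
  apply: adj_below => //; first exact: (subspaceZ l1).
  move=> g Gg; have [Sg1 Sg2] := GS Gg.
  by rewrite (ph_sym sh2)// orth// (dotZr sh1)// (ph_sym sh1).
rewrite (sqZ sh1)// => hyp.
suff [? ?] : dot2 (y - p.2) (y - p.2) <= dot2 y y / 8 /\
    dot1 p.1 p.1 <= 2 * c * dot2 y y by exists p.
have : dot2 y y = dot2 (y - p.2) (y - p.2) + 2 * (e * dot1 p.1 p.1) + dot2 p.2 p.2.
  by rewrite -orth// -(sqD sh2)// subrK.
have := ph_ge0 sh1 Sp1; have := ph_ge0 sh2 Sp2; have := ph_ge0 sh2 Syp.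
have ce : c * e = 4^-1 by rewrite /e; field; rewrite gt_eqF.
move: hyp; move: (dot2 (y - p.2) _) (dot1 p.1 p.1) (dot2 y y) (dot2 p.2 p.2)
  => a z q b hyp a0 b0 z0 qE.
have {}hyp : a <= 4^-1 * (e * z).
  by move: hyp; rewrite -ce (_ : c * (e ^+ 2 * z) = c * e * (e * z))//; ring.
have zE : z = 4 * c * (e * z) by rewrite /e; field; rewrite gt_eqF.
split; first by lra.
have : c * (e * z) <= c * (q / 2) by rewrite ler_pM2l//; lra.
by lra.
Qed.

(** The preimages of the successive residuals decrease geometrically, so that
    their sum converges, and its image is [y] because [G] is closed. *)
Lemma linear_relation_onto y : S2 y -> exists2 z, S1 z & G (z, y).
Proof.
move=> Sy; have /choice[f fP] y' : exists g, S2 y' -> [/\ G g,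
    dot2 (y' - g.2) (y' - g.2) <= dot2 y' y' / 8 &
    dot1 g.1 g.1 <= 2 * c * dot2 y' y'].
  have [/approximate_preimage[g gP]|] := pselect (S2 y'); first by exists g.
  by exists 0.
pose x := fix x k := if k is j.+1 then x j + f (y - (x j).2) else 0.
have Gx k : G (x k).
  elim: k => [|k ih] /=; first exact: lG.1.
  by apply: (subspaceD lG) => //; have [] := fP _ (subspaceB l2 Sy (GS ih).2).
have Sx k := GS (Gx k); have Syx k := subspaceB l2 Sy (Sx k).2.
have xy k : dot2 (y - (x k).2) (y - (x k).2) <= dot2 y y / 8 ^+ k.
  elim: k => [|k ih]; first by rewrite expr0 divr1 subr0.
  have [_ + _] := fP _ (Syx k); rewrite -subr_ge0 => h; rewrite rapidS.
  rewrite /= opprD addrA; move: h ih; lra.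
have [|z [Sz [C zC]]] := sh_complete sh1 (M := 2 * c * dot2 y y) (fun k => (Sx k).1).
  move=> k; have [_ _] := fP _ (Syx k).
  rewrite /= addrAC subrr add0r => /le_trans; apply; rewrite -[leRHS]mulrA ler_pM2l//.
  by rewrite mulr_gt0.
have qy0 : 0 <= dot2 y y := ph_ge0 sh2 Sy.
have C0 : 0 <= C.
  have := zC 0%N; rewrite expr0 divr1; apply: le_trans.
  exact/(ph_ge0 sh1)/(subspaceB l1)/Sz/(Sx 0%N).1.
exists z => //; apply: (cG (x := x) (C := C + dot2 y y)) => // k.
  rewrite mulrDl; apply: ler_wpDr; first by rewrite mulr_ge0 ?rapid_ge0.
  exact: zC.
rewrite mulrDl; apply: ler_wpDl; first by rewrite mulr_ge0 ?rapid_ge0.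
by rewrite (sqBC sh2)//; exact: (Sx k).2.
Qed.

End linear_relation.

(** * Null sets, rapid convergence almost everywhere *)

Section null_sets.
Context d (X : measurableType d) (R : realType).
Variables (mu : {measure set X -> \bar R}) (N : set X).
Hypotheses (mN : measurable N) (N0 : mu N = 0%E).
Import HBNNSimple.

(* a simple function below [f] may be set to zero on [N] without changing its
   integral *)
Let ge0_integral_setD_null D (f : X -> \bar R) : (forall x, 0 <= f x)%E ->
  (\int[mu]_(x in D) f x = \int[mu]_(x in D `\` N) f x)%E.
Proof.
move=> f0; rewrite integral_mkcond [RHS]integral_mkcond.
have p0 B x : (0 <= (f \_ B) x)%E by rewrite patchE; case: ifP.
rewrite !ge0_integralTE//; apply/eqP; rewrite eq_le; apply/andP; split.
  apply: ge_ereal_sup => _ [h /= hf <-]; apply: ereal_sup_ubound.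
  exists (proj_nnsfun h (measurableC mN)) => [x|].
    rewrite -mrestrict !patchE !in_setC in_setD; have := hf x; rewrite patchE.
    by case: (x \in N); rewrite ?andbF// andbT.
  rewrite -!integralT_nnsfun -mrestrict.
  rewrite [RHS](ge0_negligible_integral mN _ _ _ N0)// ?setTD; last 2 first.
  - by apply/measurable_EFinP; exact: measurable_funP.
  - by move=> x _; rewrite lee_fin.
  rewrite [RHS]integral_mkcond; apply: eq_integral => x _.
  by rewrite !patchE; case: ifP.
apply: ge_ereal_sup => _ [h /= hf <-]; apply: ereal_sup_ubound; exists h => //= x.
apply: (le_trans (hf x)); rewrite !patchE in_setD.
by case: (x \in D) => //=; case: ifP.
Qed.

(** [integral] is a lower integral of the positive and negative parts, so that
    null sets may be removed from the domain even when the integrand is not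
    measurable.  This matters for the Bochner space, whose elements are only
    almost everywhere equal to Borel maps. *)
Lemma integral_setD_null D (f : X -> \bar R) :
  (\int[mu]_(x in D) f x = \int[mu]_(x in D `\` N) f x)%E.
Proof. by rewrite integralE [RHS]integralE -!ge0_integral_setD_null. Qed.

Lemma integral_eq_off_null D (f g : X -> \bar R) :
  (forall x, D x -> ~ N x -> f x = g x) ->
  (\int[mu]_(x in D) f x = \int[mu]_(x in D) g x)%E.
Proof.
move=> fg; rewrite integral_setD_null [RHS]integral_setD_null.
by apply: eq_integral => x; rewrite inE => -[Dx Nx]; exact: fg.
Qed.

End null_sets.

Section rapid_functions.
Context d (X : measurableType d) (R : realType).
Variables (mu : {measure set X -> \bar R}) (D : set X) (mD : measurable D).
Variables (W : completeNormedModType R) (u : nat -> X -> W).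
Hypothesis mu_ : forall j k, measurable_fun D (fun x => `|u j x - u k x|).
Local Notation sqdist f g := (\int[mu]_(x in D) (`|f x - g x| ^+ 2)%:E)%E.

(** The series of the [4 ^+ k * `|u k.+1 x - u k x| ^+ 2] has a finite integral,
    hence a finite sum at almost every [x]; there the steps are [O(2 ^- k)]. *)
Lemma rapid_ae_cvg (M : R) :
  (forall k, (sqdist (u k.+1) (u k) <= (M / 8 ^+ k)%:E)%E) ->
  exists N, [/\ measurable N, mu N = 0%E &
    forall x, D x -> ~ N x -> cvgn (u ^~ x)].
Proof.
move=> uM; pose v k x := `|u k.+1 x - u k x|.
pose g k x := (4 ^+ k * v k x ^+ 2)%:E.
have mg k : measurable_fun D (g k).
  apply/measurable_EFinP; apply: measurable_funM => //.
  exact/measurable_funX/mu_.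
have v0 k x : 0 <= v k x by exact: normr_ge0.
have g0 k x : (0 <= g k x)%E by rewrite lee_fin mulr_ge0 ?exprn_ge0.
have intg k : (\int[mu]_(x in D) g k x <= (M * 2 / (2 ^ (k + 1))%:R)%:E)%E.
  under eq_integral do rewrite /g EFinM.
  rewrite ge0_integralZl_EFin ?exprn_ge0//; last 2 first.
  - by move=> x _; rewrite lee_fin exprn_ge0.
  - by apply/measurable_EFinP; exact/measurable_funX/mu_.
  apply: (@le_trans _ _ ((4 ^+ k)%:E * (M / 8 ^+ k)%:E)%E).
    by apply: lee_wpmul2l; [rewrite lee_fin exprn_ge0|exact: uM].
  rewrite -EFinM lee_fin natrX exprD expr1 (_ : 8 ^+ k = 4 ^+ k * 2 ^+ k).
    rewrite le_eqVlt; apply/orP; left; apply/eqP; field.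
    by rewrite !expf_neq0.
  by rewrite -exprMn; congr (_ ^+ _); rewrite -natrM.
have fin_sum : (\int[mu]_(x in D) (\sum_(k <oo) g k x) < +oo)%E.
  rewrite integral_nneseries//.
  apply: (@le_lt_trans _ _ (\sum_(k <oo) (M * 2 / (2 ^ (k + 1))%:R)%:E)%E).
    by apply: lee_nneseries => // k *; exact: integral_ge0.
  have /cvg_lim := @cvg_geometric_eseries_half R (M * 2) 0.
  by move=> ->//; exact: ltry.
have ig : mu.-integrable D (fun x => \sum_(k <oo) g k x)%E.
  apply/integrableP; split; first exact: ge0_emeasurable_sum.
  under eq_integral.
    move=> x _; rewrite gee0_abs; last exact: nneseries_ge0.
    over.
  exact: fin_sum.
have [N [mN N0 sN]] := integrable_ae mD ig.
exists N; split=> // x Dx Nx.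
have /fineK Gfin : (\sum_(k <oo) g k x)%E \is a fin_num.
  by apply: contrapT => h; apply: Nx; apply: sN => /= /(_ Dx).
set G := fine _ in Gfin.
have vG k : v k x <= Num.sqrt G * 2^-1 ^+ k.
  have : (g k x <= G%:E)%E.
    rewrite Gfin; apply: le_trans (nneseries_lim_ge k.+1 _) => //.
    by rewrite big_nat_recr//= leeDr// sume_ge0.
  rewrite lee_fin => gG.
  have G0 : 0 <= G by apply: le_trans gG; rewrite mulr_ge0 ?exprn_ge0.
  have -> : v k x = Num.sqrt (v k x ^+ 2) by rewrite sqrtr_sqr ger0_norm.
  rewrite -[2^-1 ^+ k]ger0_norm// -sqrtr_sqr -sqrtrM// ler_wsqrtr//.
  rewrite -exprM mulnC exprM exprVn -natrX exprVn ler_pdivlMr ?exprn_gt0//.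
  by rewrite mulrC; exact: gG.
have : cvgn (series (telescope (u ^~ x))).
  apply: normed_cvg; apply: (series_le_cvg _ _ vG) => [k|k|]; first exact: normr_ge0.
    by rewrite mulr_ge0// ?sqrtr_ge0// exprn_ge0// invr_ge0.
  by apply: is_cvg_geometric_series; rewrite ger0_norm// invf_lt1// ltr1n.
rewrite telescopeK => /is_cvgD; move=> /(_ _ (is_cvg_cst (u 0%N x))).
congr (cvgn _); apply/funext => k /=; by rewrite subrK.
Qed.

(** This is Fatou's lemma applied to the tail of the sequence. *)
Lemma rapid_sqdist_limit (f : X -> W) (N : set X) (k : nat) (B : \bar R) :
  measurable N -> mu N = 0%E ->
  (forall x, D x -> ~ N x -> u ^~ x @ \oo --> f x) ->
  (forall j, (sqdist (u (k + j)%N) (u k) <= B)%E) ->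
  (sqdist (u k) f <= B)%E.
Proof.
move=> mN N0 uf uB.
have mDN : measurable (D `\` N) by exact: measurableD.
pose h j x := (`|u (k + j)%N x - u k x| ^+ 2)%:E.
have mh j : measurable_fun (D `\` N) (h j).
  apply/measurable_EFinP; apply: measurable_funX.
  by apply: measurable_funS (mu_ _ _) => //; exact: subDsetl.
rewrite (integral_setD_null mN N0).
have -> : (\int[mu]_(x in D `\` N) (`|u k x - f x| ^+ 2)%:E =
    \int[mu]_(x in D `\` N) limn_einf (h ^~ x))%E.
  apply: eq_integral => x; rewrite inE => -[Dx Nx].
  apply/esym; apply: (cvg_limn_einf_sup _).1; apply: cvg_EFin; first exact: nearW.
  have ukf : (fun j => `|u (k + j)%N x - u k x|) @ \oo --> `|f x - u k x|.
    apply: cvg_norm; apply: cvgB; last exact: cvg_cst.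
    have := uf x Dx Nx; rewrite -(cvg_shiftn k).
    by under eq_fun do rewrite addnC.
  rewrite distrC /comp /h /=; under eq_fun do rewrite expr2.
  by rewrite expr2; exact: cvgM.
apply: le_trans (fatou mu mDN mh _) _; first by move=> j x _; rewrite lee_fin exprn_ge0.
rewrite limn_einf_lim; apply: lime_le; first exact: is_cvg_einfs.
apply: nearW => j; apply: le_trans (uB j).
rewrite (integral_setD_null mN N0) /einfs.
by apply: ereal_inf_lbound; exists j => //=.
Qed.

End rapid_functions.

(** * Scalar square integrable functions *)

Section Lfun2.
Context d (X : measurableType d) (R : realType).
Variable mu : {measure set X -> \bar R}.
Local Notation E := (LfunType mu L2_exponent).

Lemma Lfun2_integrableM (f g : E) :
  mu.-integrable setT (EFin \o (fun x => f x * g x)).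
Proof. exact/Lfun1_integrable/Lfun2_mul_Lfun1/LfunP/LfunP. Qed.

Lemma Lnorm2_sq (f : E) :
  fine ('N[mu]_(2%:E)[EFin \o f])%E ^+ 2 = \int[mu]_x (f x * f x).
Proof.
have two0 : 2 != 0 :> R by rewrite pnatr_eq0.
have := powR_Lnorm mu (EFin \o f) two0.
rewrite -finite_norm_fine poweR_EFin powR_mulrn; last by rewrite fine_ge0// Lnorm_ge0.
move=> h; transitivity (fine (\int[mu]_x (`|f x| `^ 2)%:E)).
  by rewrite -[LHS]/(fine (_%:E)) h.
by apply: eq_Rintegral => x _; rewrite powR_mulrn// -normrX ger0_norm ?sqr_ge0// expr2.
Qed.

Lemma Lfun2P (f : X -> R) : measurable_fun setT f ->
  (\int[mu]_x (`|f x| ^+ 2)%:E < +oo)%E -> f \in Lfun mu 2%:E.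
Proof.
move=> mf f2; rewrite inE; apply/andP; split; first by rewrite inE.
rewrite inE /= /finite_norm unlock /Lnorm poweR_lty//; apply: le_lt_trans f2.
by rewrite le_eqVlt; apply/orP; left; apply/eqP/eq_integral => x _; rewrite /= powR_mulrn.
Qed.

Lemma pre_hilbert_Lfun2 :
  pre_hilbert [set: E] (fun f g => \int[mu]_x (f x * g x)).
Proof.
split=> //.
- by move=> f g _ _; apply: eq_Rintegral => x _; rewrite mulrC.
- move=> a f g h _ _ _; rewrite -RintegralZl//; last exact: Lfun2_integrableM.
  rewrite -RintegralD//; last 2 first.
  + have := integrableZl measurableT a (Lfun2_integrableM f h).
    by under eq_fun do rewrite -EFinM.
  + exact: Lfun2_integrableM.
  by apply: eq_Rintegral => x _ /=; rewrite mulrDl mulrA.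
- by move=> f _; apply: Rintegral_ge0 => x _; rewrite -expr2 sqr_ge0.
Qed.

Let sqdistE (f g : E) : (\int[mu]_x (`|f x - g x| ^+ 2)%:E)%E =
  (\int[mu]_x ((f - g) x * (f - g) x))%:E.
Proof.
rewrite fineK; last exact/integrable_fin_num/Lfun2_integrableM.
by apply: eq_integral => x _; rewrite -normrX ger0_norm ?sqr_ge0// expr2.
Qed.

Lemma semi_hilbert_Lfun2 :
  semi_hilbert [set: E] (fun f g => \int[mu]_x (f x * g x)).
Proof.
split; first exact: pre_hilbert_Lfun2.
move=> u M _ uM; have uD j k : measurable_fun setT (fun x => `|u j x - u k x|).
  by apply: measurableT_comp => //; apply: measurable_funB; exact: measurable_funP.
have [|N [mN N0 uN]] := rapid_ae_cvg (mu := mu) measurableT (W := R) uD (M := M).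
  by move=> k; rewrite sqdistE lee_fin; exact: uM.
(* zeroing the sequence on [N] makes it converge everywhere, so that the limit
   is a measurable function *)
pose v k := u k \_ (~` N).
have vcvg x : cvgn (v ^~ x).
  have [Nx|Nx] := boolP (x \in ~` N); rewrite /v.
    by under eq_fun do rewrite patchE Nx; move: Nx; rewrite inE; exact: uN.
  by under eq_fun do rewrite patchE (negbTE Nx); exact: is_cvg_cst.
pose f x := limn (v ^~ x).
have mf : measurable_fun setT f.
  apply: (measurable_fun_cvg (h := v)) => [k|x _]; last exact: vcvg.
  apply/(measurable_restrictT _ _).1; first exact: measurableC.
  exact: measurable_funTS.
have uf x : [set: X] x -> ~ N x -> u ^~ x @ \oo --> f x.
  move=> _ Nx; suff -> : u ^~ x = v ^~ x by exact: vcvg.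
  by apply/funext => k; rewrite /v patchE mem_set.
have B k : (\int[mu]_x (`|u k x - f x| ^+ 2)%:E <= (3 * M / 8 ^+ k)%:E)%E.
  apply: rapid_sqdist_limit uf _ => // j; rewrite sqdistE lee_fin.
  exact: (rapid_tail pre_hilbert_Lfun2).
have fL : f \in Lfun mu 2%:E.
  have ufL : (u 0%N : X -> R) \- f \in Lfun mu 2%:E.
    apply: Lfun2P; first by apply: measurable_funB => //; exact: measurable_funP.
    by apply: le_lt_trans (B 0%N) _; exact: ltry.
  have -> : f = (u 0%N : X -> R) - ((u 0%N : X -> R) \- f).
    by apply/funext => x /=; rewrite subKr.
  by apply: rpredB => //; [exact: L2_exponent|move=> ?; exact: LfunP].
exists (Lfun_Sub L2_exponent fL); split=> //; exists (3 * M) => k.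
by rewrite -lee_fin -sqdistE.
Qed.

End Lfun2.

(** * Limits of simple maps *)

Section simple_functions.
Context d (X : measurableType d).

Definition simple_fun (P : Type) (s : X -> P) : Prop :=
  finite_set (range s) /\ forall y, measurable (s @^-1` [set y]).

Lemma simple_fun_cst (P : Type) (y : P) : simple_fun (fun=> y).
Proof.
split=> [|z]; first exact: finite_image_cst.
have [->|yz] := pselect (y = z); first by rewrite preimage_cst mem_set.
by rewrite preimage_cst memNset.
Qed.

Lemma simple_fun_preimage (P : Type) (s : X -> P) B : simple_fun s ->
  measurable (s @^-1` B).
Proof.
move=> [fs ms].
have -> : s @^-1` B = \bigcup_(y in range s `&` B) (s @^-1` [set y]).
  apply/seteqP; split=> [x Bx|x [y [_ By] /= ->]//].
  by exists (s x) => //; split=> //; exists x.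
apply: fin_bigcup_measurable => //; exact: finite_setIl.
Qed.

Lemma simple_fun_comp2 (P Q S : Type) (F : P -> Q -> S) s t :
  simple_fun s -> simple_fun t -> simple_fun (fun x => F (s x) (t x)).
Proof.
move=> [fs ms] [ft mt]; split=> [|z]; first exact: finite_image11.
have st : simple_fun (fun x => (s x, t x)).
  split=> [|[y1 y2]]; first exact: finite_image11.
  rewrite (_ : _ @^-1` _ = s @^-1` [set y1] `&` t @^-1` [set y2]).
    exact: measurableI.
  by apply/seteqP; split=> x /= [-> ->].
exact: (simple_fun_preimage [set p | F p.1 p.2 = z] st).
Qed.

Lemma simple_fun_if (P : Type) (y : P) (s : X -> P) B : measurable B ->
  simple_fun s -> simple_fun (fun x => if x \in B then s x else y).
Proof.
move=> mB [fs ms]; split=> [|z].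
  apply: (@sub_finite_set _ _ (range s `|` [set y])); last first.
    by rewrite finite_setU; split.
  by move=> _ [x _ <-]; case: ifP => _; [left; exists x|right].
rewrite (_ : _ @^-1` _ =
    (B `&` s @^-1` [set z]) `|` (~` B `&` (fun=> y) @^-1` [set z])).
  apply: measurableU; first exact: measurableI.
  by apply: measurableI; [exact: measurableC|exact: (simple_fun_cst y).2].
apply/seteqP; split=> [x /=|x /= [[Bx <-]|[Bx <-]]].
- by case: ifPn => [/set_mem|/negP]; rewrite ?inE; [left|right].
- by rewrite mem_set.
- by rewrite memNset.
Qed.

Lemma simple_fun_measurable (R : realType) (s : X -> R) : simple_fun s ->
  measurable_fun setT s.
Proof. by move=> ss _ Y _; rewrite setTI; exact: simple_fun_preimage. Qed.

End simple_functions.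

Section simple_limits.
Context d (X : measurableType d) (R : realType) (W : completeNormedModType R).

(** Strong measurability with respect to the sigma-algebra itself, without any
    exceptional null set. *)
Definition simple_limit (z : X -> W) : Prop :=
  exists s : nat -> X -> W, (forall k, simple_fun (s k)) /\
    forall x, s ^~ x @ \oo --> z x.

Lemma simple_limit_simple (s : X -> W) : simple_fun s -> simple_limit s.
Proof. by move=> ss; exists (fun=> s); split=> // x; exact: cvg_cst. Qed.

Lemma simple_limit_lin (a : R) z w : simple_limit z -> simple_limit w ->
  simple_limit (a *: z + w).
Proof.
move=> [s [ss sz]] [t [st tw]]; exists (fun k x => a *: s k x + t k x).
split=> [k|x]; first exact: (simple_fun_comp2 (fun p q => a *: p + q)).
by apply: cvgD => //; exact: cvgZr.
Qed.

(** Real functions of limits of simple maps are limits of real simple functions.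
    Measurability of maps into [W] is used in this form only. *)
Lemma simple_limit_comp2 (F : W -> W -> R) z w :
  (forall (x_ y_ : nat -> W) x y, x_ @ \oo --> x -> y_ @ \oo --> y ->
    (fun k => F (x_ k) (y_ k)) @ \oo --> F x y) ->
  simple_limit z -> simple_limit w ->
  measurable_fun setT (fun x => F (z x) (w x)).
Proof.
move=> cF [s [ss sz]] [t [st tw]].
apply: (measurable_fun_cvg (h := fun k x => F (s k x) (t k x))) => [k|x _].
  exact/simple_fun_measurable/simple_fun_comp2.
exact: cF.
Qed.

Lemma simple_limit_norm z : simple_limit z -> measurable_fun setT (fun x => `|z x|).
Proof.
move=> sz; apply: (simple_limit_comp2 (F := fun p _ => `|p|) _ sz sz).
by move=> x_ y_ x y xx _; exact: cvg_norm.
Qed.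

Lemma simple_limit_dist z w : simple_limit z -> simple_limit w ->
  measurable_fun setT (fun x => `|z x - w x|).
Proof.
apply: (simple_limit_comp2 (F := fun p q => `|p - q|)).
by move=> x_ y_ x y xx yy; apply: cvg_norm; exact: cvgB.
Qed.

Variables (mu : {measure set X -> \bar R}) (D : set X) (mD : measurable D).
Local Notation sqdist f g := (\int[mu]_(x in D) (`|f x - g x| ^+ 2)%:E)%E.
Local Notation sqnorm f := (\int[mu]_(x in D) (`|f x| ^+ 2)%:E)%E.

(** Truncating the approximations [s k] of [z] where they exceed [2 * `|z|]
    makes dominated convergence applicable. *)
Lemma simple_fun_dense z (e : R) : simple_limit z -> (sqnorm z < +oo)%E ->
  0 < e -> exists s, [/\ simple_fun s, (sqnorm s < +oo)%E & (sqdist z s <= e%:E)%E].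
Proof.
move=> sz z2 e0; have [s [ss s_cvg]] := sz.
pose B k := [set x | `|s k x| <= 2 * `|z x|].
have mz := simple_limit_norm sz.
have mB k : measurable (B k).
  rewrite -[X in measurable X]setTI; apply: measurable_fun_le => //.
    exact/simple_limit_norm/simple_limit_simple.
  exact: measurable_funM.
pose t k x := if x \in B k then s k x else 0.
have st k : simple_fun (t k) by exact: simple_fun_if.
have t_le k x : `|t k x| <= 2 * `|z x|.
  by rewrite /t; case: ifPn => [/set_mem//|_]; rewrite normr0 mulr_ge0.
have t_cvg x : t ^~ x @ \oo --> z x.
  have [z0|z0] := eqVneq (z x) 0.
    suff -> : t ^~ x = fun=> 0 by rewrite z0; exact: cvg_cst.
    apply/funext => k; apply/eqP; rewrite -normr_le0.
    by rewrite (le_trans (t_le k x))// z0 normr0 mulr0.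
  apply: cvg_trans (s_cvg x); apply: near_eq_cvg.
  have : \forall k \near \oo, `|s k x| < 2 * `|z x|.
    have zs : (fun k => `|s k x|) @ \oo --> `|z x| by apply: cvg_norm; exact: s_cvg.
    apply: (cvgr_lt _ zs).
    by rewrite ltr_pMl ?normr_gt0// ltr1n.
  by apply: filterS => k /ltW sk; rewrite /t mem_set.
have iz : mu.-integrable D (fun x => (9 * `|z x| ^+ 2)%:E).
  under eq_fun do rewrite EFinM.
  apply: integrableZl => //; apply/integrableP; split.
    exact/measurable_EFinP/measurable_funTS/measurable_funX.
  by under eq_integral do rewrite gee0_abs ?lee_fin ?exprn_ge0//.
have md k : measurable_fun D (fun x => (`|z x - t k x| ^+ 2)%:E).
  apply/measurable_EFinP/measurable_funTS/measurable_funX.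
  exact/simple_limit_dist/simple_limit_simple.
have dist_le k x : `|z x - t k x| ^+ 2 <= 9 * `|z x| ^+ 2.
  rewrite (_ : 9 * _ = (3 * `|z x|) ^+ 2); last by ring.
  rewrite ler_sqr ?nnegrE ?mulr_ge0//; apply: (le_trans (ler_normB _ _)).
  by have := t_le k x; lra.
have dist0 : (sqdist z (t k) @[k --> \oo] --> 0)%E.
  rewrite -[X in _ --> X](integral0 mu D).
  apply: (dominated_cvg mD md _ _ iz) => // [x _|k x _]; last first.
    by rewrite gee0_abs ?lee_fin ?exprn_ge0.
  apply: cvg_EFin; first exact: nearW.
  have zt : (fun k => `|z x - t k x|) @ \oo --> (0 : R).
    rewrite -(normr0 W) -(subrr (z x)); apply: cvg_norm; apply: cvgB => //.
    exact: cvg_cst.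
  rewrite /comp /=; under eq_fun do rewrite expr2.
  by rewrite -(mulr0 0); exact: cvgM.
have nbhs_e : nbhs (0 : \bar R)%E [set y | (y < e%:E)%E].
  apply: open_nbhs_nbhs; split; first exact: open_ereal_lt_ereal.
  by rewrite /= lte_fin.
have [k _ /(_ k (leqnn k))/= tk] := dist0 _ nbhs_e.
exists (t k); split; [exact: st| |exact: ltW].
have /integrableP[_ iz2] := iz; apply: le_lt_trans iz2; apply: ge0_le_integral => //.
- apply/measurable_EFinP/measurable_funTS/measurable_funX.
  exact/simple_limit_norm/simple_limit_simple.
- apply/measurableT_comp => //; apply/measurable_EFinP/measurable_funTS.
  by apply: measurable_funM => //; exact: measurable_funX.
- move=> x _; rewrite gee0_abs ?lee_fin ?mulr_ge0 ?exprn_ge0//.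
  rewrite (_ : 9 * _ = (3 * `|z x|) ^+ 2); last by ring.
  rewrite ler_sqr ?nnegrE ?mulr_ge0//; have := t_le k x; have := normr_ge0 (z x); lra.
Qed.

End simple_limits.

(** * Vector-valued square integrable functions *)

Section vector_L2.
Context d (X : measurableType d) (R : realType) (W : completeNormedModType R).
Variables (mu : {measure set X -> \bar R}) (D : set X) (mD : measurable D).
Variables (dotW : {dot W for idfun}) (dotWE : forall x, dotW x x = `|x| ^+ 2).
Local Notation sqnorm f := (\int[mu]_(x in D) (`|f x| ^+ 2)%:E)%E.

Definition ae_simple_limit (z : X -> W) : Prop :=
  exists s : nat -> X -> W, (forall k, simple_fun (s k)) /\
    {ae mu, forall x, D x -> s k x @[k --> \oo] --> z x}.

Definition vector_L2 : set (X -> W) :=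
  [set z | ae_simple_limit z /\ (sqnorm z < +oo)%E].

Definition vector_dot (z w : X -> W) : R := \int[mu]_(x in D) dotW (z x) (w x).

(** Outside a null set that contains the points of divergence, and extended by
    zero, the function becomes a limit of simple maps everywhere. *)
Lemma ae_simple_limitP z : ae_simple_limit z <->
  exists N w, [/\ measurable N, mu N = 0%E, simple_limit w &
    forall x, D x -> ~ N x -> z x = w x].
Proof.
split=> [[s [ss [N [mN N0 sN]]]]|[N [w [mN N0 [s [ss sw]] zw]]]].
  have mDN : measurable (D `\` N) by exact: measurableD.
  exists N, (fun x => if x \in D `\` N then z x else 0); split=> //.
    exists (fun k x => if x \in D `\` N then s k x else 0).
    split=> [k|x]; first exact: simple_fun_if.
    have [|_] := boolP (x \in D `\` N); last exact: cvg_cst.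
    rewrite inE => -[Dx Nx]; apply: contrapT => h; apply: Nx; apply: sN => /= h'.
    exact/h/h'.
  by move=> x Dx Nx; rewrite mem_set.
exists s; split=> //; exists N; split=> // x /= h; apply: contrapT => Nx.
by apply: h => Dx; rewrite zw//; exact: sw.
Qed.

Lemma ae_simple_limit_lin (a : R) z w :
  ae_simple_limit z -> ae_simple_limit w -> ae_simple_limit (a *: z + w).
Proof.
move=> /ae_simple_limitP[N [z' [mN N0 lz zz']]].
move=> /ae_simple_limitP[N' [w' [mN' N'0 lw ww']]].
apply/ae_simple_limitP; exists (N `|` N'), (a *: z' + w'); split.
- exact: measurableU.
- by rewrite measureU0.
- exact: simple_limit_lin.
- move=> x Dx NN'; rewrite /= !fctE zz' ?ww' => //; first by move=> ?; apply: NN'; right.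
  by move=> ?; apply: NN'; left.
Qed.

Let dotWC x y : dotW x y = dotW y x.
Proof. by rewrite hermC /= expr0 mul1r. Qed.

Let dotWl (a : R) x y z : dotW (a *: x + y) z = a * dotW x z + dotW y z.
Proof. by rewrite linearDl linearZl_LR. Qed.

Let sqnormD (a : R) x y :
  `|x + a *: y| ^+ 2 = `|x| ^+ 2 + 2 * a * dotW x y + a ^+ 2 * `|y| ^+ 2.
Proof.
rewrite -!dotWE addrC dotWl (dotWC y) (dotWC x (_ + _)) !dotWl (dotWC y x); ring.
Qed.

(* makes the form continuous, hence measurable on limits of simple maps *)
Let dotW_polar x y : dotW x y = (`|x + y| ^+ 2 - `|x - y| ^+ 2) / 4.
Proof.
by have := sqnormD 1 x y; have := sqnormD (-1) x y;
  rewrite scaleN1r scale1r => -> ->; lra.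
Qed.

Let dotW_le x y : `|dotW x y| <= `|x| ^+ 2 + `|y| ^+ 2.
Proof.
have := sqr_ge0 `|x + 1 *: y|; have := sqr_ge0 `|x + (-1) *: y|; rewrite !sqnormD.
have := sqr_ge0 `|x|; have := sqr_ge0 `|y|.
rewrite ler_norml => *; apply/andP; split; lra.
Qed.

Let measurable_dotW (z w : X -> W) : simple_limit z -> simple_limit w ->
  measurable_fun setT (fun x => dotW (z x) (w x)).
Proof.
apply: simple_limit_comp2 => x_ y_ x y xx yy; rewrite dotW_polar.
under eq_fun do rewrite dotW_polar.
apply: cvgMr_tmp; apply: cvgB; under eq_fun do rewrite expr2; rewrite expr2.
  by apply: cvgM; apply: cvg_norm; exact: cvgD.
by apply: cvgM; apply: cvg_norm; exact: cvgB.
Qed.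

Let integrable_sqr (z : X -> W) : simple_limit z -> (sqnorm z < +oo)%E ->
  mu.-integrable D (fun x => (`|z x| ^+ 2)%:E).
Proof.
move=> lz z2; apply/integrableP; split.
  exact/measurable_EFinP/measurable_funTS/measurable_funX/simple_limit_norm.
by under eq_integral do rewrite gee0_abs ?lee_fin ?exprn_ge0//.
Qed.

Let integrable_dotW (z w : X -> W) : simple_limit z -> simple_limit w ->
  (sqnorm z < +oo)%E -> (sqnorm w < +oo)%E ->
  mu.-integrable D (EFin \o (fun x => dotW (z x) (w x))).
Proof.
move=> lz lw z2 w2.
apply: le_integrable (integrableD mD (integrable_sqr lz z2) (integrable_sqr lw w2)) => //.
  exact/measurable_EFinP/measurable_funTS/measurable_dotW.
by move=> x _ /=; rewrite lee_fin (le_trans (dotW_le _ _))// ler_norm.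
Qed.

(** A square integrable function only has to be measurable up to a null set,
    so that all computations with integrals take place on such a
    representative. *)
Let repr z : vector_L2 z -> exists N w, [/\ measurable N, mu N = 0%E,
  simple_limit w, (sqnorm w < +oo)%E & forall x, D x -> ~ N x -> z x = w x].
Proof.
move=> [/ae_simple_limitP[N [w [mN N0 lw zw]]] z2]; exists N, w; split=> //.
rewrite -(integral_eq_off_null mN N0 (f := fun x => (`|z x| ^+ 2)%:E))//.
by move=> x Dx Nx; rewrite zw.
Qed.

Lemma vector_L2_sqnorm z : vector_L2 z -> sqnorm z = (vector_dot z z)%:E.
Proof.
move=> [_ z2]; under eq_integral do rewrite -dotWE.
rewrite fineK// ge0_fin_numE; first by under eq_integral do rewrite dotWE.
by apply: integral_ge0 => x _; rewrite lee_fin dotWE exprn_ge0.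
Qed.

Lemma linear_subspace_vector_L2 : linear_subspace vector_L2.
Proof.
split=> [|a z w Sz Sw].
  split; last by rewrite integral0_eq// => x _; rewrite normr0 expr0n.
  exists (fun=> 0); split=> [k|]; first exact: simple_fun_cst.
  by apply: aeW => x _; exact: cvg_cst.
split; first by apply: ae_simple_limit_lin; [exact: Sz.1|exact: Sw.1].
have [N [z' [mN N0 lz z2 zz']]] := repr Sz.
have [N' [w' [mN' N'0 lw w2 ww']]] := repr Sw.
rewrite (@integral_eq_off_null _ _ _ mu (N `|` N') _ _ D _
    (fun x => (`|a *: z' x + w' x| ^+ 2)%:E)) ?measureU0//; last 2 first.
- exact: measurableU.
- move=> x Dx NN'; rewrite /= !fctE zz' ?ww' => //; first by move=> ?; apply: NN'; right.
  by move=> ?; apply: NN'; left.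
have iz := integrable_sqr lz z2; have iw := integrable_sqr lw w2.
have /integrableP[_] :=
  integrableD mD (integrableZl mD (2 * a ^+ 2) iz) (integrableZl mD 2 iw).
apply: le_lt_trans; apply: ge0_le_integral => //.
- apply/measurable_EFinP/measurable_funTS/measurable_funX.
  exact/simple_limit_norm/simple_limit_lin.
- apply: measurableT_comp => //; apply: emeasurable_funD.
    by apply: measurable_funeM; exact: measurable_int iz.
  by apply: measurable_funeM; exact: measurable_int iw.
- move=> x _ /=; rewrite lee_fin; apply: le_trans (ler_norm _).
  have : `|a *: z' x + w' x| <= `|a| * `|z' x| + `|w' x|.
    by rewrite -normrZ ler_normD.
  have <- : `|a| ^+ 2 = a ^+ 2 by rewrite -normrX ger0_norm ?sqr_ge0.
  rewrite -ler_sqr ?nnegrE ?addr_ge0 ?mulr_ge0// => /le_trans; apply.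
  by have := sqr_ge0 (`|a| * `|z' x| - `|w' x|); lra.
Qed.

Lemma pre_hilbert_vector_L2 : pre_hilbert vector_L2 vector_dot.
Proof.
split; first exact: linear_subspace_vector_L2.
- by move=> z w _ _; apply: eq_Rintegral => x _; rewrite dotWC.
- move=> a z w v Sz Sw Sv.
  have [N [z' [mN N0 lz z2 zz']]] := repr Sz.
  have [N' [w' [mN' N'0 lw w2 ww']]] := repr Sw.
  have [N'' [v' [mN'' N''0 lv v2 vv']]] := repr Sv.
  have dotE N1 y y' : measurable N1 -> mu N1 = 0%E ->
      (forall x, D x -> ~ N1 x -> y x = y' x) ->
    vector_dot y v = \int[mu]_(x in D) dotW (y' x) (v' x).
    move=> mN1 N10 yy'; rewrite /vector_dot /Rintegral; congr fine.
    apply: (@integral_eq_off_null _ _ _ mu (N1 `|` N'')).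
    + exact: measurableU.
    + by rewrite measureU0.
    + move=> x Dx NN''; rewrite yy' ?vv' => //; last by move=> ?; apply: NN''; left.
      by move=> ?; apply: NN''; right.
  rewrite (dotE _ _ _ mN N0 zz') (dotE _ _ _ mN' N'0 ww').
  rewrite (dotE (N `|` N') _ (a *: z' + w')); first last.
  + move=> x Dx NN'; rewrite /= !fctE zz' ?ww' => //; first by move=> ?; apply: NN'; right.
    by move=> ?; apply: NN'; left.
  + by rewrite measureU0.
  + exact: measurableU.
  rewrite -RintegralZl//; last exact: integrable_dotW.
  rewrite -RintegralD//; last 2 first.
  + have := integrableZl mD a (integrable_dotW lz lv z2 v2).
    by under eq_fun do rewrite -EFinM.
  + exact: integrable_dotW.
  by apply: eq_Rintegral => x _; rewrite !fctE dotWl.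
- by move=> z _; apply: Rintegral_ge0 => x _; rewrite dotWE exprn_ge0.
Qed.

Let sqdistE z w : vector_L2 z -> vector_L2 w ->
  (\int[mu]_(x in D) (`|z x - w x| ^+ 2)%:E)%E = (vector_dot (z - w) (z - w))%:E.
Proof.
move=> Sz Sw; rewrite -vector_L2_sqnorm//.
exact: (subspaceB linear_subspace_vector_L2).
Qed.

(** The Cauchy sequence [u] is replaced by simple maps [s k] at squared distance
    at most [1 / 8 ^+ k], which still have geometrically decreasing steps.
    Their limit almost everywhere is strongly measurable by definition. *)
Lemma semi_hilbert_vector_L2 : semi_hilbert vector_L2 vector_dot.
Proof.
have ph := pre_hilbert_vector_L2; have lS := linear_subspace_vector_L2.
split=> // u M Su uM.
have /choice[s sP] k : exists s, [/\ simple_fun s, vector_L2 s &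
    vector_dot (u k - s) (u k - s) <= 1 / 8 ^+ k].
  have [N [z [mN N0 lz z2 uz]]] := repr (Su k).
  have e0 : 0 < 1 / 8 ^+ k :> R by rewrite divr_gt0// exprn_gt0.
  have [s [ss s2 zs]] := simple_fun_dense mD lz z2 e0.
  have Ss : vector_L2 s.
    split=> //; exists (fun=> s); split=> //; apply: aeW => x _.
    exact: cvg_cst.
  exists s; split=> //; rewrite -lee_fin -sqdistE//; apply: le_trans zs.
  rewrite le_eqVlt; apply/orP; left; apply/eqP; apply: (integral_eq_off_null mN N0).
  by move=> x Dx Nx; rewrite uz.
have ss k : simple_fun (s k) by have [] := sP k.
have Ss k : vector_L2 (s k) by have [] := sP k.
have us k : vector_dot (u k - s k) (u k - s k) <= 1 / 8 ^+ k by have [] := sP k.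
have sB := subspaceB lS; pose M' := 4 * M + 5.
have sM k : vector_dot (s k.+1 - s k) (s k.+1 - s k) <= M' / 8 ^+ k.
  have -> : s k.+1 - s k = (s k.+1 - u k.+1) + ((u k.+1 - u k) + (u k - s k)).
    by rewrite (addrA (_ - u k)) subrK addrA subrK.
  have Sus := subspaceD lS (sB _ _ (Su k.+1) (Su k)) (sB _ _ (Su k) (Ss k)).
  apply: (le_trans (sqD_le ph (sB _ _ (Ss _) (Su _)) Sus)).
  have := sqD_le ph (sB _ _ (Su k.+1) (Su k)) (sB _ _ (Su k) (Ss k)).
  have := us k.+1; rewrite (sqBC ph (Su k.+1) (Ss k.+1)) rapidS.
  have := us k; have := uM k; have := rapid_ge0 (R:=R) k; rewrite /M' !div1r; lra.
have ms j k : measurable_fun D (fun x => `|s j x - s k x|).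
  by apply/measurable_funTS/simple_limit_dist; exact: simple_limit_simple.
have [|N [mN N0 sN]] := rapid_ae_cvg (mu := mu) mD ms (M := M').
  by move=> k; rewrite sqdistE// lee_fin.
pose z x := limn (s ^~ x).
have lz : ae_simple_limit z.
  exists s; split=> //; exists N; split=> // x /= h; apply: contrapT => Nx.
  by apply: h => Dx; exact: sN.
have sz k : ((\int[mu]_(x in D) (`|s k x - z x| ^+ 2)%:E) <= (3 * M' / 8 ^+ k)%:E)%E.
  apply: (rapid_sqdist_limit mD ms mN N0 sN) => j; rewrite sqdistE// lee_fin.
  exact: (rapid_tail ph).
have Sz : vector_L2 z.
  rewrite -(subKr (s 0%N) z); apply: sB; first exact: Ss.
  split; last by apply: le_lt_trans (sz 0%N) _; exact: ltry.
  rewrite addrC -scaleN1r; apply: ae_simple_limit_lin => //; exact: (Ss 0%N).1.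
exists z; split=> //; exists (2 + 6 * M') => k.
have -> : u k - z = (u k - s k) + (s k - z) by rewrite addrA subrK.
apply: (le_trans (sqD_le ph (sB _ _ (Su _) (Ss _)) (sB _ _ (Ss _) Sz))).
have := us k; have := sz k; rewrite sqdistE// lee_fin div1r; lra.
Qed.

End vector_L2.

(** * Products with test functions on a bounded domain *)

Section bounded_domain.
Context {R : realType}.

Let box n (M : R) : set 'rV[R]_n := [set x | forall i, `|x 0 i| <= M].

Let measurable_box n M : measurable (@box n M).
Proof.
rewrite (_ : box M = \bigcap_(i in [set: 'I_n]) (rV_coord i @^-1` `[- M, M])); last first.
  by apply/seteqP; split=> [x xM i _|x xM i]; have := xM i;
    rewrite /rV_coord/= in_itv/= -ler_norml//; exact.
apply: fin_bigcap_measurable => // i _; rewrite -[X in measurable X]setTI.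
by apply: measurable_rV_coord => //; exact: measurable_itv.
Qed.

Let lebesgue_rV_box n M : (lebesgue_rV n (@box n M) < +oo)%E.
Proof.
elim: n => [|n ih]; first by rewrite /= diracE ltry.
rewrite /= /lebesgue_cons /pushforward.
have -> : @rV_cons R n @^-1` box M = `[- M, M]%classic `*` @box n M.
  apply/seteqP; split=> [[t x] xM|[t x] [/= tM xM] i].
    split=> /=.
      by have := xM ord0; rewrite /= mxE unlift_none in_itv/= -ler_norml.
    by move=> i; have := xM (lift ord0 i); rewrite /= mxE liftK.
  rewrite mxE; case: (unlift ord0 i) => [j|/=]; first exact: xM.
  by move: tM; rewrite in_itv/= -ler_norml.
rewrite product_measure1E//; last exact: measurable_box.
rewrite lte_mul_pinfty// ge0_fin_numE//.
exact/compact_finite_measure/segment_compact.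
Qed.

Lemma bounded_lebesgue_rV n (D : set 'rV[R]_n.+1) : measurable D ->
  bounded_set D -> (lebesgue_rV n.+1 D < +oo)%E.
Proof.
move=> mD [M [_ /(_ (M + 1)) DM]].
apply: le_lt_trans (lebesgue_rV_box n.+1 (M + 1)).
apply: le_measure; rewrite ?inE//; first exact: measurable_box.
move=> x Dx i; apply: le_trans (DM _ x Dx); last by rewrite ltrDl.
rewrite /Num.norm/= mx_normrE; apply: (le_trans _ (le_bigmax _ _ (0, i))); exact: lexx.
Qed.

Variables (n : nat) (D : set 'rV[R]_n.+1) (mD : measurable D) (bD : bounded_set D).
Local Notation E := (L2 mD).

(** The domain lies in a compact ball. *)
Lemma continuous_bounded_on (psi : 'rV[R]_n.+1 -> R) : continuous psi ->
  [bounded psi x | x in D].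
Proof.
move=> cpsi; have [M [_ /(_ (M + 1)) DM]] := bD.
have cB : compact [set x : 'rV[R]_n.+1 | `|x| <= M + 1].
  apply: bounded_closed_compact.
    exists (M + 1); split; first exact: num_real.
    by move=> t Mt x /= /le_trans; apply; exact: ltW.
  apply: (@closed_comp _ _ (fun x : 'rV[R]_n.+1 => `|x|) [set t | t <= M + 1]).
    by move=> x _; exact: norm_continuous.
  exact: closed_le.
have := compact_bounded (continuous_compact (continuous_subspaceT cpsi) cB).
rewrite /bounded_set => -[C [Cr CP]]; exists C; split=> // t Ct x Dx.
by apply: (CP t Ct); exists x => //=; apply: DM => //; rewrite ltrDl.
Qed.

Lemma continuous_measurable_rV (psi : 'rV[R]_n.+1 -> R) : continuous psi ->
  measurable_fun setT psi.
Proof.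
move=> cpsi; apply: (measurability _ (RGenOpens.measurableE R)) => //.
move=> _ [_ [a [b ->] <-]].
rewrite setTI; apply: open_rV_measurable; apply: open_comp => //.
Qed.

Lemma integrable_mrestr (f : 'rV[R]_n.+1 -> \bar R) :
  (mrestr (lebesgue_rV n.+1) mD).-integrable setT f ->
  (lebesgue_rV n.+1).-integrable D f.
Proof.
move=> /integrableP[mf f_fin]; apply/integrableP; split; first exact: measurable_funTS.
rewrite (eq_measure_integral (mrestr (lebesgue_rV n.+1) mD)); last first.
  by move=> A mA AD; rewrite -[RHS]/(lebesgue_rV n.+1 (A `&` D)) setIidl.
apply: le_lt_trans f_fin; apply: ge0_subset_integral => //.
exact: measurableT_comp.
Qed.

(** On a set of finite measure a square integrable function is integrable, and
    it remains so after multiplication by a function bounded on that set. *)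
Lemma integrable_L2M (f : E) (psi : 'rV[R]_n.+1 -> R) : continuous psi ->
  (lebesgue_rV n.+1).-integrable D (EFin \o (fun x => f x * psi x)).
Proof.
move=> cpsi.
have f1 : (f : _ -> R) \in Lfun (mrestr (lebesgue_rV n.+1) mD) 1.
  apply: Lfun_subset12; last exact: LfunP.
  rewrite ge0_fin_numE// -[ltLHS]/(lebesgue_rV n.+1 (setT `&` D)) setTI.
  exact: bounded_lebesgue_rV.
have := integrableMl mD (integrable_mrestr ((Lfun1_integrable _ _).1 f1))
  (measurable_funTS (continuous_measurable_rV cpsi)) (continuous_bounded_on cpsi).
by apply: eq_integrable => //.
Qed.
End bounded_domain.

(** * Linearity of the gradient on H^1_0 *)

Section gradient.
Context {R : realType} {n : nat}.
Local Notation X := 'rV[R]_n.+1.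
Implicit Types (D : set X) (f g phi : X -> R).

Lemma test_function_continuous D phi (s : seq 'I_n.+1) : test_function D phi ->
  continuous (foldr partial phi s).
Proof. by move=> [dphi _] x; exact/differentiable_continuous/dphi. Qed.

Let foldr_partial_lin (a : R) f g (s : seq 'I_n.+1) :
  (forall s x, differentiable (foldr partial f s) x) ->
  (forall s x, differentiable (foldr partial g s) x) ->
  foldr partial (a *: f + g) s = a *: foldr partial f s + foldr partial g s.
Proof.
move=> df dg; elim: s => //= i s ->; apply/funext => x; rewrite /partial.
rewrite deriveD ?deriveZ//; first exact: diff_derivable.
  by apply: derivableZ; exact: diff_derivable.
exact: diff_derivable.
Qed.

Lemma test_function_lin D (a : R) f g : test_function D f -> test_function D g ->
  test_function D (a *: f + g).
Proof.
move=> [df [K [cK KD fK]]] [dg [L [cL LD gL]]]; split.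
  move=> s x; rewrite foldr_partial_lin//.
  by apply: differentiableD => //; exact: differentiableZ.
exists (K `|` L); split; [exact: compactU|by move=> x []; [exact: KD|exact: LD]|].
move=> x /not_orP[Kx Lx]; rewrite /= !fctE fK ?gL//.
by rewrite scaler0 addr0.
Qed.

Lemma test_function0 D : test_function D 0.
Proof.
split; last by exists set0; split=> //; exact: compact0.
move=> s x; rewrite (_ : foldr _ _ _ = 0); first exact: differentiable_cst.
elim: s => //= i s ->; apply/funext => y; exact: derive_cst.
Qed.

Variables (D : set X) (mD : measurable D) (bD : bounded_set D).
Local Notation E := (L2 mD).
Implicit Types (u v : E).

Lemma weak_partial_lin (i : 'I_n.+1) (a : R) (u v u' v' : E) :
  weak_partial D i u u' -> weak_partial D i v v' ->
  weak_partial D i (a *: u + v) (a *: u' + v').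
Proof.
move=> wu wv phi tphi.
have lin (w w' : E) (psi : X -> R) : continuous psi ->
    \int[lebesgue_rV n.+1]_(x in D) ((a *: w + w') x * psi x) =
    a * \int[lebesgue_rV n.+1]_(x in D) (w x * psi x) +
    \int[lebesgue_rV n.+1]_(x in D) (w' x * psi x).
  move=> cpsi; rewrite -RintegralZl//; last exact: integrable_L2M.
  rewrite -RintegralD//; last exact: integrable_L2M.
    by apply: eq_Rintegral => x _ /=; rewrite mulrDl mulrA.
  have := integrableZl mD a (integrable_L2M bD w cpsi).
  by under eq_fun do rewrite -EFinM.
rewrite !lin; [|exact: (test_function_continuous (s := [::]) tphi)
               |exact: (test_function_continuous (s := [:: i]) tphi)].
by rewrite wu// wv// opprD mulrN.
Qed.

Lemma weak_partial0 (i : 'I_n.+1) : weak_partial D i (0 : E) (0 : E).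
Proof.
move=> phi _; rewrite /Rintegral !integral0_eq ?oppr0// => x _.
  by rewrite mul0r.
by rewrite mul0r.
Qed.

Lemma L2_cvg_lin (a : R) (u_ v_ : nat -> E) (u v : E) :
  L2_cvg u_ u -> L2_cvg v_ v -> L2_cvg (fun k => a *: u_ k + v_ k) (a *: u + v).
Proof.
move=> cu cv; rewrite /L2_cvg.
have b : (fun k => `|a| * L2_norm (u_ k - u) + L2_norm (v_ k - v)) @ \oo --> (0 : R).
  have ca : (fun k => `|a| * L2_norm (u_ k - u)) @ \oo --> `|a| * 0.
    by apply: cvgM; [exact: cvg_cst|exact: cu].
  by have := cvgD ca cv; rewrite mulr0 addr0; exact.
apply: (squeeze_cvgr _ (cvg_cst 0) b); apply: nearW => k; apply/andP; split.
  by rewrite /L2_norm fine_ge0// Lnorm_ge0.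
have -> : a *: u_ k + v_ k - (a *: u + v) = a *: (u_ k - u) + (v_ k - v).
  by rewrite scalerBr opprD addrACA.
apply: (le_trans (ler_LnormD _ _)); rewrite lerD2r /L2_norm.
rewrite (_ : EFin \o _ = EFin \o (a \*: (u_ k - u : E)))// LnormZ fineM//.
by rewrite -finite_norm_fine.
Qed.

Lemma H10_gradient_lin (a : R) (u v : E) (g h : 'I_n.+1 -> E) :
  H10_gradient u g -> H10_gradient v h ->
  H10_gradient (a *: u + v) (fun i => a *: g i + h i).
Proof.
move=> [ug [p [dp [tp wp pu pg]]]] [vh [q [dq [tq wq qv qh]]]]; split.
  by move=> i; exact: weak_partial_lin.
exists (fun k => a *: p k + q k), (fun k i => a *: dp k i + dq k i); split.
- by move=> k; exact: (test_function_lin a (tp k) (tq k)).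
- by move=> k i; exact: (weak_partial_lin a (wp k i) (wq k i)).
- exact: L2_cvg_lin.
- by move=> i; exact: L2_cvg_lin.
Qed.

Lemma H10_gradient0 : H10_gradient (0 : E) (fun=> 0).
Proof.
split; first by move=> i; exact: weak_partial0.
exists (fun=> 0), (fun _ _ => 0).
have cvg00 : L2_cvg (fun=> 0 : E) 0.
  have N0 : L2_norm (0 - 0 : E) = 0.
    by rewrite subrr /L2_norm (_ : EFin \o _ = cst 0%E)// Lnorm0.
  by rewrite /L2_cvg N0; exact: cvg_cst.
split=> //; first by move=> k; exact: test_function0.
by move=> k i; exact: weak_partial0.
Qed.

End gradient.

(** * The relation [H_operator] and its adjoint *)

Section observability.
Context {R : realType} {n : nat} {O : completeNormedModType R}.
Variables (D : set 'rV[R]_n.+1) (mD : measurable D) (bD : bounded_set D).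
Local Notation E := (L2 mD).
Variables (alpha T : R) (lam : nat -> R) (r : nat -> nat)
  (phi : nat -> nat -> E) (domC : set E) (C : E -> O).
Variables (dotO : {dot O for idfun}) (dotOE : forall x, dotO x x = `|x| ^+ 2).
Variables (om : set 'rV[R]_n.+1) (mom : measurable om).
Local Notation Y := ('I_n.+1 -> L2 mom).
Local Notation H := (H_operator (T:=T) alpha lam r phi domC C dotO (mom:=mom)).
Local Notation Hadj := (H_adjoint (T:=T) alpha lam r phi domC C dotO (mom:=mom)).
Local Notation Z := (vector_L2 (W := O) (@lebesgue_measure R) `[0, T]%classic).
Local Notation dotZ := (vector_dot (@lebesgue_measure R) `[0, T]%classic dotO).

Let shZ : semi_hilbert Z dotZ.
Proof. exact: semi_hilbert_vector_L2. Qed.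

Let shY : semi_hilbert [set y : Y | forall i, [set: L2 mom] (y i)]
  (@L2n_dot R n om mom).
Proof. exact/semi_hilbert_sum/semi_hilbert_Lfun2. Qed.

Let shE : semi_hilbert [set: E] (@L2_dot R n D mD).
Proof. exact: semi_hilbert_Lfun2. Qed.

Let inY (y : Y) : [set y : Y | forall i, [set: L2 mom] (y i)] y.
Proof. by []. Qed.

Let inZ (z : bochner_L2 O T) : Z z.
Proof. by split; [exact: bochner_measurable|exact: bochner_finite]. Qed.

Let toZ (z : R -> O) (Sz : Z z) : bochner_L2 O T := BochnerL2 (T := T) Sz.1 Sz.2.

Let L2n_normE (y : Y) : L2n_norm y ^+ 2 = L2n_dot y y.
Proof.
rewrite sqr_sqrtr; first by apply: eq_bigr => i _; exact: Lnorm2_sq.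
by apply: sumr_ge0 => i _; exact: sqr_ge0.
Qed.

Let L2n_norm_ge0 (y : Y) : 0 <= L2n_norm y.
Proof. exact: sqrtr_ge0. Qed.

Let bochner_normE (z : R -> O) : Z z -> bochner_norm T z ^+ 2 = dotZ z z.
Proof.
move=> Sz; rewrite /bochner_norm sqr_sqrtr.
  by rewrite /bochner_sqnorm (vector_L2_sqnorm dotOE Sz).
by rewrite fine_ge0// integral_ge0// => x _; rewrite lee_fin exprn_ge0.
Qed.

Let bochner_norm_ge0 (z : R -> O) : 0 <= bochner_norm T z.
Proof. exact: sqrtr_ge0. Qed.

Let H_lin (a : R) (z w v : bochner_L2 O T) (y x : Y) :
  v = a *: (z : R -> O) + (w : R -> O) :> (R -> O) -> H z y -> H w x ->
  H v (a *: y + x).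
Proof.
move=> vE [p [g [zp pg gy]]] [q [h [wq qh hx]]].
exists (a *: p + q), (fun i => a *: g i + h i); split.
- move=> u0 u Ku; have zpu := zp u0 u Ku; have wqu := wq u0 u Ku.
  rewrite -[LHS]/(dotZ u v) vE (ph_sym shZ)//; last by rewrite -vE.
  rewrite (ph_lin shZ)// (ph_sym shZ (inZ z))// (ph_sym shZ (inZ w))//.
  rewrite -[dotZ u z]/(bochner_dot dotO u z) -[dotZ u w]/(bochner_dot dotO u w).
  rewrite zpu wqu [RHS](ph_sym shE)// (ph_lin shE)//.
  by rewrite (ph_sym shE (x := p))// (ph_sym shE (x := q)).
- exact: H10_gradient_lin.
- move=> i; have gi := gy i; have hi := hx i.
  apply: filterS2 gi hi => t gt ht _.
  rewrite -[LHS]/(a * g i t + h i t) -[RHS]/(a * y i t + x i t).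
  by congr (a * _ + _); [exact: gt|exact: ht].
Qed.

Let H0 (v : bochner_L2 O T) : v = 0 :> (R -> O) -> H v 0.
Proof.
move=> vE; exists 0, (fun=> 0); split.
- move=> u0 u Ku.
  rewrite -[LHS]/(dotZ u v) vE (ph_sym shZ)//; last by rewrite -vE.
  rewrite (dot0l shZ)//.
  by rewrite [RHS](ph_sym shE)// (dot0l shE).
- exact: H10_gradient0.
- by move=> i; apply: aeW.
Qed.

(** The graph as a subset of a vector space: the records of [bochner_L2] carry
    proofs and have no vector space structure of their own. *)
Let graph : set ((R -> O) * Y) :=
  [set p | exists2 z : bochner_L2 O T, z = p.1 :> (R -> O) & H z p.2].

Let graph_sub p : graph p -> Z p.1.
Proof. by move=> [z <- _]. Qed.

Let graph_lin : linear_subspace graph.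
Proof.
split; first by exists (toZ (ph_subspace shZ).1) => //; exact: H0.
move=> a [p1 p2] [q1 q2] [z zE Hz] [w wE Hw].
have Sv := (ph_subspace shZ).2 a _ _ (inZ z) (inZ w).
exists (toZ Sv); first by rewrite /= zE wE.
exact: (H_lin (z := z) (w := w)).
Qed.

Let image_lin : linear_subspace (in_image H).
Proof.
split; first by have [z _ Hz] := graph_lin.1; exists z.
move=> a y x [z Hz] [w Hw].
have Sv := (ph_subspace shZ).2 a _ _ (inZ z) (inZ w).
by exists (toZ Sv); exact: H_lin Hz Hw.
Qed.

Let L2n_cvg_rapid (y_ : nat -> Y) y (c : R) :
  (forall k, L2n_dot (y_ k - y) (y_ k - y) <= c / 8 ^+ k) -> L2n_cvg y_ y.
Proof.
move=> yc; apply: (rapid_cvg0 (c := c)) => k; first exact: L2n_norm_ge0.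
by rewrite L2n_normE; exact: yc.
Qed.

Let bochner_cvg_rapid (z_ : nat -> bochner_L2 O T) (z : bochner_L2 O T) (c : R) :
  (forall k, dotZ ((z_ k : R -> O) - (z : R -> O))
    ((z_ k : R -> O) - (z : R -> O)) <= c / 8 ^+ k) ->
  bochner_cvg z_ z.
Proof.
move=> zc; apply: (rapid_cvg0 (c := c)) => k; first exact: bochner_norm_ge0.
rewrite (bochner_normE (z := (z_ k : R -> O) - (z : R -> O))); first exact: zc.
exact: (subspaceB (ph_subspace shZ)).
Qed.

Let bochner_CS (z w : bochner_L2 O T) :
  bochner_dot dotO z w ^+ 2 <= bochner_norm T z ^+ 2 * bochner_norm T w ^+ 2.
Proof. by rewrite !bochner_normE//; exact: (cauchy_schwarz shZ). Qed.

Let L2n_CS (y x : Y) : L2n_dot y x ^+ 2 <= L2n_norm y ^+ 2 * L2n_norm x ^+ 2.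
Proof. by rewrite !L2n_normE; exact: (cauchy_schwarz shY). Qed.

Let zeroZ : bochner_L2 O T := toZ (ph_subspace shZ).1.

Let bochner_dot0 (z : bochner_L2 O T) : bochner_dot dotO z zeroZ = 0.
Proof.
rewrite -[LHS]/(dotZ z 0) (ph_sym shZ)//; last exact: (ph_subspace shZ).1.
exact: (dot0l shZ).
Qed.

Let bochner_norm0 : bochner_norm T zeroZ = 0.
Proof.
apply/eqP; rewrite -sqrf_eq0 bochner_normE//; apply/eqP; exact: bochner_dot0.
Qed.

Lemma exact_trivial_kernel :
  exactly_G_observable alpha T lam r phi domC C dotO mom ->
  trivial_kernel_H_adjoint alpha T lam r phi domC C dotO mom.
Proof.
move=> ex u; split=> [[w w0 uw]|u0].
  have [z Hz] := ex u; apply/eqP; rewrite -sqrf_eq0 L2n_normE (uw z u Hz) -sqrf_eq0.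
  rewrite eq_le sqr_ge0 andbT (le_trans (bochner_CS _ _))//.
  by rewrite w0 expr0n mulr0.
exists zeroZ => // z y Hz; rewrite bochner_dot0; apply/eqP; rewrite -sqrf_eq0.
by rewrite eq_le sqr_ge0 andbT (le_trans (L2n_CS _ _))// u0 expr0n mulr0.
Qed.

(** A vector orthogonal to the image is in the domain of the adjoint, and the
    adjoint relates it to zero. *)
Lemma trivial_kernel_closed_exact :
  trivial_kernel_H_adjoint alpha T lam r phi domC C dotO mom ->
  closed_image_H alpha T lam r phi domC C dotO mom ->
  exactly_G_observable alpha T lam r phi domC C dotO mom.
Proof.
move=> ker cl y.
apply: (closed_subspace_full shY (G := in_image H) _ image_lin) (inY y) => //.
  by move=> y_ x c Hy _ yx; apply: cl Hy _; exact: L2n_cvg_rapid yx.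
move=> u _ uH; rewrite -L2n_normE (ker u).1 ?expr0n//.
exists zeroZ; first exact: bochner_norm0.
move=> z x Hz; rewrite bochner_dot0 (ph_sym shY)//; apply: uH; by exists z.
Qed.

(** Uniform boundedness for the [u] with [H^* u] in the unit ball; a general
    [u] is scaled into this set. *)
Lemma exact_bounded_below :
  exactly_G_observable alpha T lam r phi domC C dotO mom ->
  H_adjoint_bounded_below alpha T lam r phi domC C dotO mom.
Proof.
move=> ex.
pose U := [set u : Y | exists2 w, Hadj u w & bochner_norm T w <= 1].
have [//||c c0 Uc] := uniform_boundedness shY (U := U).
  move=> y _; have [z Hz] := ex y; exists (bochner_norm T z ^+ 2) => u [w uw w1].
  rewrite (uw _ _ Hz) (le_trans (bochner_CS _ _))// ler_piMr ?sqr_ge0//.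
  by rewrite expr_le1.
have Hadj_scale (t : R) u w : Hadj u w -> 0 <= t -> t * bochner_norm T w <= 1 ->
    t ^+ 2 * L2n_dot u u <= c.
  move=> uw t0 tw; have Sw := subspaceZ (ph_subspace shZ) t (inZ w).
  rewrite -(sqZ shY)//; apply: Uc; exists (toZ Sw).
    move=> z y Hz; rewrite (dotZr shY)// (uw _ _ Hz).
    by rewrite -[RHS]/(dotZ z (t *: (w : R -> O))) (dotZr shZ).
  rewrite -(@ler_sqr R) ?nnegrE// expr1n bochner_normE// (sqZ shZ)//.
  by rewrite -bochner_normE// -exprMn expr_le1// mulr_ge0.
exists (Num.sqrt c); first by rewrite sqrtr_gt0.
move=> u w uw; rewrite -ler_sqr ?nnegrE ?mulr_ge0 ?sqrtr_ge0//.
rewrite L2n_normE exprMn sqr_sqrtr ?(ltW c0)//.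
have [w0|w0] := eqVneq (bochner_norm T w) 0.
  (* then every multiple of [u] is in [U] *)
  rewrite w0 expr0n mulr0; apply: (@le0_rapid _ _ c) => k.
  have t0 : 0 <= Num.sqrt (8 ^+ k) :> R by exact: sqrtr_ge0.
  have := Hadj_scale _ _ _ uw t0; rewrite w0 mulr0 => /(_ ler01).
  by rewrite sqr_sqrtr ?exprn_ge0// ler_pdivlMr ?exprn_gt0// mulrC.
have w_gt0 : 0 < bochner_norm T w by rewrite lt_neqAle eq_sym w0 bochner_norm_ge0.
have := Hadj_scale (bochner_norm T w)^-1 _ _ uw.
rewrite invr_ge0 mulVf// => /(_ (ltW w_gt0) (lexx _)).
by rewrite exprVn mulrC ler_pdivrMr// exprn_gt0.
Qed.

Lemma closed_graph_bounded_below_exact :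
  closed_graph_H alpha T lam r phi domC C dotO mom ->
  H_adjoint_bounded_below alpha T lam r phi domC C dotO mom ->
  exactly_G_observable alpha T lam r phi domC C dotO mom.
Proof.
move=> cl [c c0 below] y.
have graphS : graph `<=` Z `*` [set y : Y | forall i, [set: L2 mom] (y i)].
  by move=> p /graph_sub.
have [|u w _ Sw uw|z Sz [z' z'E Hz]] :=
    linear_relation_onto shZ shY graphS graph_lin _ (exprn_gt0 2 c0) _ (inY y).
- move=> x [z x'] b Gx Sz _ xz xx'.
  have /choice[z_ z_P] k : exists z' : bochner_L2 O T,
      z' = (x k).1 :> (R -> O) /\ H z' (x k).2.
    by have [z' ? ?] := Gx k; exists z'.
  exists (toZ Sz) => //; apply: (cl z_ (fun k => (x k).2)).
  + by move=> k; exact: (z_P k).2.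
  + by apply: (bochner_cvg_rapid (c := b)) => k; rewrite (z_P k).1; exact: xz.
  + exact: L2n_cvg_rapid xx'.
- have uw' : Hadj u (toZ Sw) by move=> z x Hz; apply: (uw (z : R -> O, x)); exists z.
  have := below _ _ uw'; rewrite -L2n_normE -bochner_normE// -exprMn.
  by rewrite ler_sqr ?nnegrE ?mulr_ge0// ltW.
- by exists z'.
Qed.

End observability.

Theorem proposition6 (R : realType) (n : nat)
  (Omega : set 'rV[R]_n.+1) (Omega_open : open Omega)
  (Omega_bounded : bounded_set Omega) (Omega_connected : connected Omega)
  (Omega_lipschitz : lipschitz_boundary Omega)
  (T : R) (T_gt0 : 0 < T) (alpha : R) (alpha_gt0 : 0 < alpha) (alpha_le1 : alpha <= 1)
  (a : 'I_n.+1 -> 'I_n.+1 -> 'rV[R]_n.+1 -> R)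
  (a_C1 : forall k l, C1_closure Omega (a k l))
  (a_sym : forall k l x, closure Omega x -> a k l x = a l k x)
  (a_elliptic : uniformly_elliptic Omega a)
  (lam : nat -> R) (r : nat -> nat)
  (phi : nat -> nat -> L2 (open_rV_measurable Omega_open))
  (phi_basis : eigenbasis a lam r phi)
  (O : completeNormedModType R) (dotO : {dot O for idfun})
  (O_hilbert : forall x, dotO x x = `|x| ^+ 2)
  (domC : set (L2 (open_rV_measurable Omega_open)))
  (C : L2 (open_rV_measurable Omega_open) -> O)
  (C_linear : linear_operator domC C)
  (C_admissible : admissible alpha T lam r phi domC C a)
  (omega : set 'rV[R]_n.+1) (omega_measurable : measurable omega)
  (omega_sub : omega `<=` Omega) :
  [/\ exactly_G_observable alpha T lam r phi domC C dotO omega_measurable <->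
      trivial_kernel_H_adjoint alpha T lam r phi domC C dotO omega_measurable /\
      closed_image_H alpha T lam r phi domC C dotO omega_measurable,
      exactly_G_observable alpha T lam r phi domC C dotO omega_measurable ->
      H_adjoint_bounded_below alpha T lam r phi domC C dotO omega_measurable &
      closed_graph_H alpha T lam r phi domC C dotO omega_measurable ->
      H_adjoint_bounded_below alpha T lam r phi domC C dotO omega_measurable ->
      exactly_G_observable alpha T lam r phi domC C dotO omega_measurable].
Proof.
split=> [|ex|cl below].
- split=> [ex|[ker cl]]; last exact: trivial_kernel_closed_exact.
  split; first exact: exact_trivial_kernel.
  by move=> y_ y _ _; exact: ex.
- exact: exact_bounded_below.
- exact: closed_graph_bounded_below_exact.
Qed.
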